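(* Let $(\Omega,d)$ be a non-degenerate strongly finite-dimensional $*$-differential calculus of dimension $N$ over the Hopf $*$-algebra $\mathcal{A}$ associated to a compact quantum group $G$, with $\dim(\Omega^{\mathrm{inv}}_N)=1$ and $d(\Omega^{\mathrm{inv}}_{N-1})=0$. Let $h$ be the Haar integral of $\mathcal{A}$, $\theta$ a volume element, $\int$ the associated integral and $\sigma$ its twist automorphism. Then there exists a graded, left-invariant inner product $(\cdot\mid\cdot)$ on $\Omega$ such that $(\sigma(\omega)\mid\omega)\ge0$ for all $\omega\in\Omega$ if, and only if, $h(a^*\sigma(a))\ge0$ for all $a\in\mathcal{A}$.
   Context: All spaces are over $\mathbb{C}$; inner products are linear in the first variable. $G=(A,\Delta)$ is a compact quantum group in the sense of Woronowicz. Its associated Hopf $*$-algebra $\mathcal{A}$ is the linear span of the matrix elements of all finite-dimensional irreducible unitary representations of $G$; $h$ is its (positive, faithful) Haar integral. A graded $*$-algebra is an algebra $\Omega=\bigoplus_{n\ge 0}\Omega_n$ with $\Omega_m\Omega_n\subseteq\Omega_{m+n}$ and a conjugate-linear degree-zero map $\omega\mapsto\omega^*$ with $(\omega^* )^*=\omega$ and $(\omega_1\omega_2)^*=(-1)^{kl}\omega_2^*\omega_1^*$ for $\omega_1\in\Omega_k,\omega_2\in\Omega_l$. A graded $*$-differential algebra is a pair $(\Omega,d)$ with $\Omega$ a graded $*$-algebra and $d$ a linear map of degree $1$ with $d^2=0$, $d(\omega^* )=(d\omega)^*$ and $d(\omega'\omega)=d(\omega')\omega+(-1)^k\omega'd\omega$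 for $\omega'\in\Omega_k$. A $*$-differential calculus over $\mathcal{A}$ is a graded $*$-differential algebra $(\Omega,d)$ such that: (1) $\Omega_0=\mathcal{A}$ as $*$-algebras and $\Omega_k$ ($k>0$) is the linear span of products $a_0\,da_1\cdots da_k$, $a_i\in\mathcal{A}$; (2) there is an algebra homomorphism $\Delta_\Omega:\Omega\to\mathcal{A}\otimes\Omega$ extending $\Delta$ with $(\mathrm{id}_{\mathcal{A}}\otimes d)\Delta_\Omega=\Delta_\Omega d$; (3) $d1=0$. $\Omega^{\mathrm{inv}}=\{\omega:\Delta_\Omega(\omega)=1\otimes\omega\}$, $\Omega^{\mathrm{inv}}_k=\Omega_k\cap\Omega^{\mathrm{inv}}$; $a\otimes\omega\mapsto a\omega$ is an isomorphism of left $\mathcal{A}$-modules $\mathcal{A}\otimes\Omega^{\mathrm{inv}}\to\Omega$. Strongly finite dimensional means $\dim\Omega^{\mathrm{inv}}<\infty$; the dimension is the $N$ with $\Omega_N\ne0$, $\Omega_k=0$ for $k>N$. Non-degenerate: whenever $0\le k\le N$, $\omega\in\Omega_k$ and $\omega'\omega=0$ for all $\omega'\in\Omega_{N-k}$, then $\omega=0$. An inner product on $\Omega$ is graded if the $\Omega_k$ are pairwise orthogonal, and left-invariant if $(a\omega\mid b\eta)=h(b^*a)(\omega\mid\eta)$ for $a,b\in\mathcal{A}$, $\omega,\eta\in\Omega^{\mathrm{inv}}$. A volume element is $\theta\in\Omega^{\mathrm{inv}}_N$, $\theta^*=\theta\neq0$, normalised to be a unit vector for a fixed inner product on $\Omega$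 (the normalisation does not affect $\sigma$). The associated integral is the linear functional with $\int\omega=0$ for $\omega\in\Omega_k$, $k<N$, and $\int a\theta=h(a)$, $a\in\mathcal{A}$. The twist automorphism of $\int$ is the unique degree-zero algebra automorphism $\sigma$ of $\Omega$ with $\sigma d=d\sigma$ and $\int\omega'\omega=(-1)^{kl}\int\sigma(\omega)\omega'$ for $\omega\in\Omega_k$, $\omega'\in\Omega_l$ (it exists under the present hypotheses). *)

(* Defs.v *)
From HB Require Import structures.
From mathcomp Require Import all_boot all_order all_algebra.
From mathcomp Require Import generic_quotient.
From mathcomp Require Import all_classical all_reals all_analysis.
From mathcomp Require Import complex.

Set Implicit Arguments.
Unset Strict Implicit.
Unset Printing Implicit Defensive.

Import Order.TTheory GRing.Theory Num.Theory.
Import numFieldNormedType.Exports.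
Local Open Scope quotient_scope.
Local Open Scope classical_set_scope.
Local Open Scope ring_scope.

Reserved Notation "a *t b" (at level 40, left associativity).

Section LinearAlgebra.
Context (K : fieldType) (V : lmodType K).

Definition lspan (S : set V) : set V :=
  [set v | exists s : seq (K * V),
     (forall p, p \in s -> S p.2) /\ v = \sum_(p <- s) p.1 *: p.2].

Definition lin_indep n (b : 'I_n -> V) : Prop :=
  forall c : 'I_n -> K, \sum_i c i *: b i = 0 -> forall i, c i = 0.

Definition has_dim (S : set V) (n : nat) : Prop :=
  exists b : 'I_n -> V, lin_indep b /\ S = lspan (range b).

Lemma exists_functional (v : V) : v != 0 ->
  exists f : V -> K, (forall c x y, f (c *: x + y) = c * f x + f y) /\ f v = 1.
Proof.
move=> v0.
pose P (M : set V) :=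
  (forall (c : K) x y, M x -> M y -> M (c *: x + y)) /\ ~ M v.
have [M [[Mlin Mv] Mmax]] : exists A, P A /\ forall B, A `<` B -> ~ P B.
  apply: Zorn_bigcup => F FP Ftot; split; last first.
    by case=> X FX Xv; case: (FP _ FX).
  move=> c x y [X FX Xx] [Y FY Yy]; have [XY|YX] := Ftot _ _ FX FY.
    by exists Y => //; apply: (FP _ FY).1 => //; apply: XY.
  by exists X => //; apply: (FP _ FX).1 => //; apply: YX.
have M0 : M 0.
  apply: contrapT => nM0; apply: (Mmax (M `|` [set 0])).
    by split; [move=> x; left|move=> /(_ 0) h; apply/nM0/h; right].
  split; last by case=> // /eqP; rewrite (negPf v0).
  move=> c x y [Mx|->] [My|->]; rewrite ?scaler0 ?add0r; try by [left|right].
  - by left; exact: Mlin.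
  - by exfalso; apply: nM0; rewrite -[0](addNr x) -scaleN1r; exact: Mlin.
have MZ c x : M x -> M (c *: x).
  by move=> Mx; rewrite -[_ *: _]addr0; exact: Mlin.
have MD x y : M x -> M y -> M (x + y).
  by move=> Mx My; rewrite -[x]scale1r; exact: Mlin.
have Mdec x : exists c, M (x - c *: v).
  have [Mx|nMx] := pselect (M x); first by exists 0; rewrite scale0r subr0.
  pose B := [set y | exists m (c : K), M m /\ y = m + c *: x].
  have MB : M `<` B.
    split; first by move=> m Mm; exists m, 0; rewrite scale0r addr0.
    by move=> /(_ x) h; apply/nMx/h; exists 0, 1; rewrite scale1r add0r.
  have Blin (c : K) y z : B y -> B z -> B (c *: y + z).
    move=> [m [e [Mm ->]]] [m' [e' [Mm' ->]]].
    exists (c *: m + m'), (c * e + e'); split; first exact: Mlin.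
    by rewrite scalerDr scalerDl scalerA addrACA.
  have /contrapT [m [c [Mm vE]]] : ~ ~ B v by move=> nBv; exact: (Mmax _ MB).
  have c0 : c != 0.
    by apply/eqP => c0; apply: Mv; rewrite vE c0 scale0r addr0.
  exists c^-1; rewrite vE scalerDr scalerA mulVf// scale1r opprD addrCA subrr.
  by rewrite addr0 -scaleNr; exact: MZ.
have Muniq x c e : M (x - c *: v) -> M (x - e *: v) -> c = e.
  move=> Mc Me; apply/eqP; rewrite -subr_eq0; apply/negP => ce0; apply: Mv.
  have : M ((- (c - e)^-1) *: (x - c *: v) + (c - e)^-1 *: (x - e *: v)).
    by apply: Mlin => //; exact: MZ.
  rewrite scaleNr -scalerN -scalerDr opprB.
  have -> : c *: v - x + (x - e *: v) = (c - e) *: v.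
    by rewrite addrA subrK scalerBl.
  by rewrite scalerA mulVf ?scale1r//; exact/negP.
have /choice [f fP] := Mdec.
exists f; split => [c x y|].
  apply: (Muniq (c *: x + y)) (fP _) _.
  rewrite scalerDl -scalerA opprD addrACA -scalerBr; exact: Mlin.
by apply: (Muniq v) (fP _) _; rewrite scale1r subrr.
Qed.

End LinearAlgebra.

Section Tensor.
Context (K : fieldType).

Definition bilin (A B V : lmodType K) (f : A -> B -> V) : Prop :=
  (forall b (c : K) x y, f (c *: x + y) b = c *: f x b + f y b) /\
  (forall a (c : K) x y, f a (c *: x + y) = c *: f a x + f a y).

Section Quotient.
Context (A B : lmodType K).
Implicit Types (V : lmodType K) (s t : seq (A * B)).

Definition tsum V (f : A -> B -> V) s : V := \sum_(p <- s) f p.1 p.2.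

(* Formal sums of pairs are identified when no bilinear map into any vector *)
(* space separates them, which is equality in the algebraic tensor product. *)
Definition tensor_rel s t : bool :=
  `[< forall V (f : A -> B -> V), bilin f -> tsum f s = tsum f t >].

Lemma tensor_rel_refl : reflexive tensor_rel.
Proof. by move=> s; apply/asboolP. Qed.

Lemma tensor_rel_sym : symmetric tensor_rel.
Proof.
by move=> s t; apply/idP/idP => /asboolP h; apply/asboolP => V f /h ->.
Qed.

Lemma tensor_rel_trans : transitive tensor_rel.
Proof.
move=> t s u /asboolP st /asboolP tu; apply/asboolP => V f bf.
by rewrite st// tu.
Qed.

Canonical tensor_equiv :=
  EquivRel tensor_rel tensor_rel_refl tensor_rel_sym tensor_rel_trans.
Definition tensor := {eq_quot tensor_equiv}.
HB.instance Definition _ := Choice.on tensor.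
HB.instance Definition _ := EqQuotient.on tensor.

Definition tpi s : tensor := \pi_tensor s.

Lemma tpiP s t :
  (forall V (f : A -> B -> V), bilin f -> tsum f s = tsum f t) -> tpi s = tpi t.
Proof. by move=> st; apply/eqmodP/asboolP. Qed.

Lemma tensor_ind (P : tensor -> Prop) : (forall s, P (tpi s)) -> forall x, P x.
Proof. by move=> h x; rewrite -[x]reprK; exact: h. Qed.

Definition tlift V (f : A -> B -> V) (x : tensor) : V := tsum f (repr x).

Lemma tlift_pi V (f : A -> B -> V) s : bilin f -> tlift f (tpi s) = tsum f s.
Proof.
by rewrite /tlift => bf; case: piP => t /eqmodP /asboolP h; rewrite h.
Qed.

Lemma tensor_eqP (x y : tensor) :
  (forall V (f : A -> B -> V), bilin f -> tlift f x = tlift f y) -> x = y.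
Proof. by move=> h; rewrite -[x]reprK -[y]reprK; apply: tpiP => V f /h. Qed.

Definition topp s := [seq (- p.1, p.2) | p <- s].
Definition tscale (c : K) s := [seq (c *: p.1, p.2) | p <- s].

Definition tzero : tensor := tpi [::].
Definition tensor_opp (x : tensor) := tpi (topp (repr x)).
Definition tensor_add (x y : tensor) := tpi (repr x ++ repr y).
Definition tensor_scale (c : K) (x : tensor) := tpi (tscale c (repr x)).

Section LiftProps.
Context V (f : A -> B -> V) (bf : bilin f).

Lemma bilin0l b : f 0 b = 0.
Proof. by have := bf.1 b (-1) 0 0; rewrite scaler0 addr0 scaleN1r addNr. Qed.
Lemma bilin0r a : f a 0 = 0.
Proof. by have := bf.2 a (-1) 0 0; rewrite scaler0 addr0 scaleN1r addNr. Qed.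
Lemma bilinZl c a b : f (c *: a) b = c *: f a b.
Proof. by have := bf.1 b c a 0; rewrite addr0 bilin0l addr0. Qed.
Lemma bilinZr c a b : f a (c *: b) = c *: f a b.
Proof. by have := bf.2 a c b 0; rewrite addr0 bilin0r addr0. Qed.

Lemma tlift0 : tlift f tzero = 0.
Proof. by rewrite tlift_pi// /tsum big_nil. Qed.
Lemma tliftD x y : tlift f (tensor_add x y) = tlift f x + tlift f y.
Proof. by rewrite tlift_pi// /tsum big_cat. Qed.
Lemma tliftZ c x : tlift f (tensor_scale c x) = c *: tlift f x.
Proof.
rewrite tlift_pi// /tsum big_map /tlift /tsum scaler_sumr.
by apply: eq_bigr => p _; exact: bilinZl.
Qed.
Lemma tliftN x : tlift f (tensor_opp x) = - tlift f x.
Proof.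
rewrite tlift_pi// /tsum big_map /tlift /tsum -sumrN.
by apply: eq_bigr => p _; rewrite /= -(scaleN1r p.1) bilinZl scaleN1r.
Qed.
End LiftProps.

Fact tensor_addA : associative tensor_add.
Proof. by move=> x y z; apply: tensor_eqP => V f bf; rewrite !tliftD// addrA. Qed.
Fact tensor_addC : commutative tensor_add.
Proof. by move=> x y; apply: tensor_eqP => V f bf; rewrite !tliftD// addrC. Qed.
Fact tensor_add0 : left_id tzero tensor_add.
Proof. by move=> x; apply: tensor_eqP => V f bf; rewrite tliftD// tlift0// add0r. Qed.
Fact tensor_addN : left_inverse tzero tensor_opp tensor_add.
Proof.
by move=> x; apply: tensor_eqP => V f bf; rewrite tliftD// tliftN// tlift0// addNr.
Qed.
HB.instance Definition _ :=
  GRing.isZmodule.Build tensor tensor_addA tensor_addC tensor_add0 tensor_addN.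

Fact tensor_scaleA c e x :
  tensor_scale c (tensor_scale e x) = tensor_scale (c * e) x.
Proof. by apply: tensor_eqP => V f bf; rewrite !tliftZ// scalerA. Qed.
Fact tensor_scale1 : left_id 1 tensor_scale.
Proof. by move=> x; apply: tensor_eqP => V f bf; rewrite tliftZ// scale1r. Qed.
Fact tensor_scaleDr : right_distributive tensor_scale +%R.
Proof.
move=> c x y; apply: tensor_eqP => V f bf.
by rewrite tliftZ// !tliftD// !tliftZ// scalerDr.
Qed.
Fact tensor_scaleDl x : {morph tensor_scale^~ x : c e / c + e}.
Proof.
move=> c e; apply: tensor_eqP => V f bf.
by rewrite tliftZ// !tliftD// !tliftZ// scalerDl.
Qed.
HB.instance Definition _ := GRing.Zmodule_isLmodule.Build K tensor
  tensor_scaleA tensor_scale1 tensor_scaleDr tensor_scaleDl.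

Definition tpure (a : A) (b : B) : tensor := tpi [:: (a, b)].

Lemma tlift_linear V (f : A -> B -> V) : bilin f ->
  forall (c : K) x y, tlift f (c *: x + y) = c *: tlift f x + tlift f y.
Proof. by move=> bf c x y; rewrite tliftD// tliftZ. Qed.

Lemma tlift_pure V (f : A -> B -> V) a b : bilin f -> tlift f (tpure a b) = f a b.
Proof. by move=> bf; rewrite tlift_pi// /tsum big_seq1. Qed.

Lemma tpure_bilin : bilin tpure.
Proof.
split=> [b c x y|a c x y]; apply: tensor_eqP => V f bf.
  by rewrite tlift_linear// !tlift_pure// bf.1.
by rewrite tlift_linear// !tlift_pure// bf.2.
Qed.

Lemma tpi_sum s : tpi s = \sum_(p <- s) tpure p.1 p.2.
Proof.
elim: s => [|[a b] s IHs]; first by rewrite big_nil.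
rewrite big_cons -IHs; apply: tensor_eqP => V f bf.
by rewrite tliftD// tlift_pure// !tlift_pi// /tsum big_cons.
Qed.

Lemma tlift_uniq V (g1 g2 : tensor -> V) :
  (forall (c : K) x y, g1 (c *: x + y) = c *: g1 x + g1 y) ->
  (forall (c : K) x y, g2 (c *: x + y) = c *: g2 x + g2 y) ->
  (forall a b, g1 (tpure a b) = g2 (tpure a b)) -> g1 =1 g2.
Proof.
move=> l1 l2 e; have z (g : tensor -> V) :
    (forall (c : K) x y, g (c *: x + y) = c *: g x + g y) -> g 0 = 0.
  by move=> /(_ (-1) 0 0); rewrite scaler0 addr0 scaleN1r addNr.
elim/tensor_ind => s; rewrite tpi_sum; elim: s => [|p s IHs].
  by rewrite !big_nil !z.
by rewrite big_cons -[tpure _ _]scale1r l1 l2 IHs e.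
Qed.

End Quotient.

End Tensor.
Notation "a *t b" := (tpure a b).

Section TensorMaps.
Context (K : fieldType).

Definition tmap (A B A' B' : lmodType K) (f : A -> A') (g : B -> B') :
    tensor A B -> tensor A' B' :=
  tlift (fun a b => f a *t g b).

Definition tassoc (A B C : lmodType K) :
    tensor A (tensor B C) -> tensor (tensor A B) C :=
  tlift (fun a x => tlift (fun b c => (a *t b) *t c) x).

End TensorMaps.

Section TensorAlgebra.
Context (K : fieldType) (A B : algType K).
Local Notation T := (tensor A B).

Definition tmul1 (c : A) (e : B) : T -> T :=
  tlift (fun a b => (c * a) *t (e * b)).
Definition tensor_mul (x y : T) : T := tlift (fun a b => tmul1 a b y) x.
Definition tensor_one : T := 1 *t 1.

Lemma tmul1_bilin c e : bilin (fun (a : A) (b : B) => (c * a) *t (e * b)).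
Proof.
have [pl pr] := @tpure_bilin K A B.
by split=> *; rewrite mulrDr -scalerAr ?pl ?pr.
Qed.

Lemma tmul_bilin (y : T) : bilin (fun (a : A) (b : B) => tmul1 a b y).
Proof.
have [pl pr] := @tpure_bilin K A B.
split=> [b c a a'|a c b b']; rewrite /tmul1 /tlift /tsum scaler_sumr -big_split;
by apply: eq_bigr => p _; rewrite mulrDl -scalerAl ?pl ?pr.
Qed.

Lemma tensor_mul_linl y (c : K) x x' :
  tensor_mul (c *: x + x') y = c *: tensor_mul x y + tensor_mul x' y.
Proof. by rewrite /tensor_mul tlift_linear//; exact: tmul_bilin. Qed.

Lemma tensor_mul_linr y (c : K) x x' :
  tensor_mul y (c *: x + x') = c *: tensor_mul y x + tensor_mul y x'.
Proof.
rewrite /tensor_mul /tlift /tsum scaler_sumr -big_split.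
by apply: eq_bigr => p _; exact: (tlift_linear (tmul1_bilin _ _)).
Qed.

Lemma tensor_mul_pure a b a' b' :
  tensor_mul (a *t b) (a' *t b') = (a * a') *t (b * b').
Proof.
rewrite /tensor_mul tlift_pure; last exact: tmul_bilin.
by rewrite /tmul1 tlift_pure//; exact: tmul1_bilin.
Qed.

Fact tensor_mulA : associative tensor_mul.
Proof.
move=> x y z; move: x; apply: tlift_uniq => [c u v|c u v|a b];
  rewrite ?tensor_mul_linl//.
move: y; apply: tlift_uniq => [c u v|c u v|a' b'];
  rewrite ?(tensor_mul_linl, tensor_mul_linr)//.
move: z; apply: tlift_uniq => [c u v|c u v|a'' b''];
  rewrite ?tensor_mul_linr//.
by rewrite !tensor_mul_pure !mulrA.
Qed.

Fact tensor_mul1 : left_id tensor_one tensor_mul.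
Proof.
apply: tlift_uniq => [c x y|c x y|a b]; rewrite ?tensor_mul_linr//.
by rewrite tensor_mul_pure !mul1r.
Qed.

Fact tensor_1mul : right_id tensor_one tensor_mul.
Proof.
apply: tlift_uniq => [c x y|c x y|a b]; rewrite ?tensor_mul_linl//.
by rewrite tensor_mul_pure !mulr1.
Qed.

Fact tensor_mulDl : left_distributive tensor_mul +%R.
Proof.
by move=> x x' y; have := tensor_mul_linl y 1 x x'; rewrite !scale1r.
Qed.

Fact tensor_mulDr : right_distributive tensor_mul +%R.
Proof.
by move=> y x x'; have := tensor_mul_linr y 1 x x'; rewrite !scale1r.
Qed.

Fact tensor_one_neq0 : tensor_one != 0.
Proof.
have [f [lf f1]] := exists_functional (oner_neq0 A).
have [g [lg g1]] := exists_functional (oner_neq0 B).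
pose fg (a : A) (b : B) : K^o := f a * g b.
have bfg : bilin fg.
  split=> [b c x y|a c x y]; rewrite /fg.
    by rewrite lf mulrDl -mulrA.
  by rewrite lg mulrDr mulrCA.
apply/eqP => e; have := tlift_pure 1 1 bfg; rewrite -/tensor_one e.
by rewrite tlift0// /fg f1 g1 mulr1 => /esym/eqP; rewrite oner_eq0.
Qed.

HB.instance Definition _ := GRing.Zmodule_isNzRing.Build T tensor_mulA
  tensor_mul1 tensor_1mul tensor_mulDl tensor_mulDr tensor_one_neq0.

Lemma tpureM a b a' b' : (a *t b) * (a' *t b') = (a * a') *t (b * b') :> T.
Proof. exact: tensor_mul_pure. Qed.

Fact tensor_scaleAl (c : K) (x y : T) : c *: (x * y) = (c *: x) * y.
Proof.
have := tensor_mul_linl y c x 0; rewrite addr0 => h; rewrite [RHS]h.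
by rewrite -[tensor_mul 0 y]/((0 : T) * y) mul0r addr0.
Qed.
HB.instance Definition _ := GRing.Lmodule_isLalgebra.Build K T tensor_scaleAl.

Fact tensor_scaleAr (c : K) (x y : T) : c *: (x * y) = x * (c *: y).
Proof.
have := tensor_mul_linr x c y 0; rewrite addr0 => h; rewrite [RHS]h.
by rewrite -[tensor_mul x 0]/(x * (0 : T)) mulr0 addr0.
Qed.
HB.instance Definition _ := GRing.Lalgebra_isAlgebra.Build K T tensor_scaleAr.

End TensorAlgebra.

HB.mixin Record isStarAlgebra (R : realType) A & GRing.Algebra R[i] A := {
  star : A -> A;
  starK : involutive star;
  starD : {morph star : x y / x + y};
  starZ : forall (c : R[i]) (x : A), star (c *: x) = c^* *: star x;
  starM : forall x y : A, star (x * y) = star y * star x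
}.

#[short(type="starAlgType")]
HB.structure Definition StarAlgebra (R : realType) :=
  {A of GRing.Algebra R[i] A & isStarAlgebra R A}.

Section TensorStar.
Context (R : realType).

Section Conjugate.
Context (V : lmodType R[i]).

(* [V] with conjugate scalar action, to lift conjugate-bilinear maps. *)
Definition conj_space : Type := V.
HB.instance Definition _ := GRing.Zmodule.on conj_space.
Definition conj_scale (c : R[i]) (v : conj_space) : conj_space :=
  c^* *: (v : V).
Fact conj_scaleA c e v : conj_scale c (conj_scale e v) = conj_scale (c * e) v.
Proof. by rewrite /conj_scale scalerA rmorphM. Qed.
Fact conj_scale1 : left_id 1 conj_scale.
Proof. by move=> v; rewrite /conj_scale rmorph1 scale1r. Qed.
Fact conj_scaleDr : right_distributive conj_scale +%R.
Proof. by move=> c u v; exact: (@scalerDr _ V). Qed.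
Fact conj_scaleDl v : {morph conj_scale^~ v : c e / c + e}.
Proof. by move=> c e; rewrite /conj_scale rmorphD; exact: (@scalerDl _ V). Qed.
HB.instance Definition _ := GRing.Zmodule_isLmodule.Build R[i] conj_space
  conj_scaleA conj_scale1 conj_scaleDr conj_scaleDl.
End Conjugate.

Context (A B : starAlgType R).
Local Notation T := (tensor A B).

Definition tensor_star (x : T) : T :=
  tlift (fun a b => star a *t star b : conj_space T) x.

Lemma tstar_bilin : bilin (fun (a : A) (b : B) => star a *t star b : conj_space T).
Proof.
have [pl pr] := @tpure_bilin R[i] A B.
by split=> *; rewrite starD starZ ?pl ?pr.
Qed.

Lemma tensor_star_pure a b : tensor_star (a *t b) = star a *t star b.
Proof. exact: (tlift_pure _ _ tstar_bilin). Qed.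

Lemma tensor_star_linear (c : R[i]) (x y : T) :
  tensor_star (c *: x + y) = c^* *: tensor_star x + tensor_star y.
Proof. exact: (tlift_linear tstar_bilin). Qed.

Fact tensor_starD : {morph tensor_star : x y / x + y}.
Proof.
by move=> x y; have := tensor_star_linear 1 x y; rewrite !scale1r rmorph1 scale1r.
Qed.

Fact tensor_starZ (c : R[i]) (x : T) : tensor_star (c *: x) = c^* *: tensor_star x.
Proof.
have s0 : tensor_star 0 = 0 by apply: (addrI (tensor_star 0)); rewrite -tensor_starD !addr0.
by have := tensor_star_linear c x 0; rewrite !addr0 s0 addr0.
Qed.

Fact tensor_starK : involutive tensor_star.
Proof.
apply: tlift_uniq => [c x y|c x y|a b] //.
  by rewrite !tensor_star_linear conjCK.
by rewrite !tensor_star_pure !starK.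
Qed.

Fact tensor_starM (x y : T) : tensor_star (x * y) = tensor_star y * tensor_star x.
Proof.
suff : (fun x => tensor_star (x * y) : conj_space T) =1
       (fun x => tensor_star y * tensor_star x : conj_space T) by apply.
apply: tlift_uniq => [c u v|c u v|a b].
- by rewrite mulrDl -scalerAl tensor_star_linear.
- by rewrite tensor_star_linear mulrDr -scalerAr.
suff : (fun y => tensor_star (a *t b * y) : conj_space T) =1
       (fun y => tensor_star y * tensor_star (a *t b) : conj_space T) by apply.
apply: tlift_uniq => [c u v|c u v|a' b'].
- by rewrite mulrDr -scalerAr tensor_star_linear.
- by rewrite tensor_star_linear mulrDl -scalerAl.
by rewrite !(tensor_star_pure, tpureM) !starM.
Qed.

HB.instance Definition _ := isStarAlgebra.Build R T
  tensor_starK tensor_starD tensor_starZ tensor_starM.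

End TensorStar.

Definition star_preserving (R : realType) (A B : starAlgType R) (f : A -> B) : Prop :=
  forall x, f (star x) = star (f x).

Record is_cstar_norm (R : realType) (A : starAlgType R) (nrm : A -> R) : Prop := {
  csn_ge0 : forall x, 0 <= nrm x;
  csn_eq0 : forall x, nrm x = 0 -> x = 0;
  csn_triangle : forall x y, nrm (x + y) <= nrm x + nrm y;
  csn_scale : forall (c : R[i]) x, nrm (c *: x) = ComplexField.Normc.normc c * nrm x;
  csn_mul : forall x y, nrm (x * y) <= nrm x * nrm y;
  csn_star : forall x, nrm (star x * x) = nrm x ^+ 2
}.

(* Unital C*-algebras.  Library normed modules are not reused here because    *)
(* the hierarchy has no join of rings with normed Z-modules below numDomain.  *)
Record cstar_algebra (R : realType) := {
  csa_alg :> starAlgType R;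
  csa_norm : csa_alg -> R;
  csa_normP : is_cstar_norm csa_norm;
  csa_complete : forall u : nat -> csa_alg,
    (forall e : R, 0 < e -> exists m : nat, forall i j : nat,
       (m <= i)%N -> (m <= j)%N -> csa_norm (u i - u j) < e) ->
    exists l, forall e : R, 0 < e -> exists m : nat, forall i : nat,
       (m <= i)%N -> csa_norm (u i - l) < e
}.

Definition csa_dense (R : realType) (A : cstar_algebra R) (S : set A) : Prop :=
  forall (x : A) (e : R), 0 < e -> exists2 y, S y & csa_norm (x - y) < e.

(* [T] is the completion of the algebraic tensor product for the least        *)
(* C*-norm (by Takesaki's theorem, the spatial one).                          *)
Record is_min_tensor (R : realType) (A B T : cstar_algebra R)
    (i : {lrmorphism tensor A B -> T}) : Prop := {
  mint_inj : injective i;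
  mint_star : star_preserving i;
  mint_dense : csa_dense (range i);
  mint_min : forall nrm : tensor A B -> R, is_cstar_norm nrm ->
    forall x, csa_norm (i x) <= nrm x
}.

(* [cq_alg3] is the triple minimal tensor product, presented both as          *)
(* (A (x) A) (x) A and as A (x) (A (x) A); [cq_comul_l] and [cq_comul_r] are   *)
(* the *-homomorphisms Delta (x) id and id (x) Delta on the completion        *)
(* A (x) A, determined by their values on pure tensors because                *)
(* *-homomorphisms of C*-algebras are continuous.                             *)
Record compact_quantum_group (R : realType) := {
  cq_alg :> cstar_algebra R;
  cq_alg2 : cstar_algebra R;
  cq_incl2 : {lrmorphism tensor cq_alg cq_alg -> cq_alg2};
  cq_incl2P : is_min_tensor cq_incl2;
  cq_alg3 : cstar_algebra R;
  cq_incl21 : {lrmorphism tensor cq_alg2 cq_alg -> cq_alg3};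
  cq_incl21P : is_min_tensor cq_incl21;
  cq_incl12 : {lrmorphism tensor cq_alg cq_alg2 -> cq_alg3};
  cq_incl12P : is_min_tensor cq_incl12;
  cq_inclA : forall a b c : cq_alg,
    cq_incl21 (cq_incl2 (a *t b) *t c) = cq_incl12 (a *t cq_incl2 (b *t c));
  cq_comul : {lrmorphism cq_alg -> cq_alg2};
  cq_comul_star : star_preserving cq_comul;
  cq_comul_l : {lrmorphism cq_alg2 -> cq_alg3};
  cq_comul_l_star : star_preserving cq_comul_l;
  cq_comul_lE : forall a b : cq_alg,
    cq_comul_l (cq_incl2 (a *t b)) = cq_incl21 (cq_comul a *t b);
  cq_comul_r : {lrmorphism cq_alg2 -> cq_alg3};
  cq_comul_r_star : star_preserving cq_comul_r;
  cq_comul_rE : forall a b : cq_alg,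
    cq_comul_r (cq_incl2 (a *t b)) = cq_incl12 (a *t cq_comul b);
  cq_coassoc : forall a : cq_alg, cq_comul_l (cq_comul a) = cq_comul_r (cq_comul a);
  cq_cancel_l : csa_dense (lspan
    [set x | exists a b : cq_alg, x = cq_comul a * cq_incl2 (b *t 1)]);
  cq_cancel_r : csa_dense (lspan
    [set x | exists a b : cq_alg, x = cq_comul a * cq_incl2 (1 *t b)])
}.

Section Representations.
Context (R : realType) (G : compact_quantum_group R).

Definition is_unitary_rep n (u : 'M[G]_n) : Prop :=
  let ustar := \matrix_(i < n, j < n) star (u j i) in
  [/\ ustar *m u = 1%:M, u *m ustar = 1%:M &
      forall i j, cq_comul G (u i j) = \sum_k cq_incl2 G (u i k *t u k j)].

(* Subspaces of C^n are given as ranges of idempotents [p]; the range of [p]  *)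
(* is invariant under [u] when [u p = p u p].                                 *)
Definition irreducible_rep n (u : 'M[G]_n) : Prop :=
  (0 < n)%N /\
  forall p : 'M[R[i]]_n, p *m p = p ->
    let pG : 'M[G]_n := map_mx (fun c => c%:A) p in
    u *m pG = pG *m u *m pG -> p = 0 \/ p = 1%:M.

Definition matrix_element : set G :=
  [set x | exists n (u : 'M[G]_n),
     [/\ is_unitary_rep u, irreducible_rep u & exists i j, x = u i j]].

End Representations.

Record hopf_star_algebra (R : realType) := {
  hopf_alg :> starAlgType R;
  comul : {lrmorphism hopf_alg -> tensor hopf_alg hopf_alg};
  comul_star : star_preserving comul;
  comulA : forall a, tassoc (tmap id comul (comul a)) = tmap comul id (comul a);
  counit : {lrmorphism hopf_alg -> R[i]^o};
  counitl : forall a, tlift (fun x y => counit x *: y) (comul a) = a;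
  counitr : forall a, tlift (fun x y => counit y *: x) (comul a) = a;
  antipode : {linear hopf_alg -> hopf_alg};
  antipodel : forall a, tlift (fun x y => antipode x * y) (comul a) = (counit a)%:A;
  antipoder : forall a, tlift (fun x y => x * antipode y) (comul a) = (counit a)%:A
}.

(* [H] is, up to the isomorphism [j] onto its image, the span in C(G) of the  *)
(* matrix elements, with the coproduct of [G].                                *)
Definition associated_hopf (R : realType) (G : compact_quantum_group R)
    (H : hopf_star_algebra R) : Prop :=
  exists j : {lrmorphism H -> G},
    [/\ injective j, star_preserving j, range j = lspan (@matrix_element R G) &
        forall a, cq_incl2 G (tmap j j (comul H a)) = cq_comul G (j a)].

Record is_haar (R : realType) (H : hopf_star_algebra R) (h : {scalar H}) : Prop := {
  haar1 : h 1 = 1;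
  haar_invl : forall a, tlift (fun x y => h y *: x) (comul H a) = (h a)%:A;
  haar_invr : forall a, tlift (fun x y => h x *: y) (comul H a) = (h a)%:A;
  haar_ge0 : forall a, 0 <= h (star a * a);
  haar_faithful : forall a, h (star a * a) = 0 -> a = 0
}.

Record graded_star_algebra (R : realType) := {
  gr_alg :> algType R[i];
  gr_deg : nat -> set gr_alg;
  gr_deg0 : forall k, gr_deg k 0;
  gr_deg_lin : forall k (c : R[i]) x y,
    gr_deg k x -> gr_deg k y -> gr_deg k (c *: x + y);
  gr_sum : forall w, exists n (f : nat -> gr_alg),
    (forall i, gr_deg i (f i)) /\ w = \sum_(i < n) f i;
  gr_direct : forall n (f : nat -> gr_alg), (forall i, gr_deg i (f i)) ->
    \sum_(i < n) f i = 0 -> forall i, (i < n)%N -> f i = 0;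
  gr_mul : forall k l x y, gr_deg k x -> gr_deg l y -> gr_deg (k + l)%N (x * y);
  gr_star : gr_alg -> gr_alg;
  gr_starD : {morph gr_star : x y / x + y};
  gr_starZ : forall (c : R[i]) x, gr_star (c *: x) = c^* *: gr_star x;
  gr_star_deg : forall k x, gr_deg k x -> gr_deg k (gr_star x);
  gr_starK : involutive gr_star;
  gr_starM : forall k l x y, gr_deg k x -> gr_deg l y ->
    gr_star (x * y) = (-1) ^+ (k * l) * (gr_star y * gr_star x)
}.

Record graded_star_diff_algebra (R : realType) := {
  gd_alg :> graded_star_algebra R;
  gd_d : {linear gd_alg -> gd_alg};
  gd_d_deg : forall k x, gr_deg k x -> gr_deg k.+1 (gd_d x);
  gd_dd : forall x, gd_d (gd_d x) = 0;
  gd_d_star : forall x, gd_d (gr_star x) = gr_star (gd_d x);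
  gd_leibniz : forall k x y, gr_deg k x ->
    gd_d (x * y) = gd_d x * y + (-1) ^+ k * (x * gd_d y)
}.

(* The identification of [H] with the degree-zero part is the embedding       *)
(* [sc_emb].                                                                  *)
Record star_calculus (R : realType) (H : hopf_star_algebra R) := {
  sc_alg :> graded_star_diff_algebra R;
  sc_emb : {lrmorphism H -> sc_alg};
  sc_emb_inj : injective sc_emb;
  sc_emb_range : range sc_emb = gr_deg (g := sc_alg) 0;
  sc_emb_star : forall a, sc_emb (star a) = gr_star (sc_emb a);
  sc_span : forall k, gr_deg (g := sc_alg) k = lspan
    [set w | exists (a : H) (b : 'I_k -> H),
       w = sc_emb a * \prod_(i < k) gd_d sc_alg (sc_emb (b i))];
  sc_coact : {lrmorphism sc_alg -> tensor H sc_alg};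
  sc_coact_emb : forall a, sc_coact (sc_emb a) = tmap id sc_emb (comul H a);
  sc_coact_d : forall w,
    tmap id (gd_d sc_alg) (sc_coact w) = sc_coact (gd_d sc_alg w);
  sc_d1 : gd_d sc_alg 1 = 0
}.

Section Calculus.
Context (R : realType) (H : hopf_star_algebra R) (Om : star_calculus H).
Local Notation iota := (sc_emb Om).
Local Notation d := (gd_d Om).

Definition calc_deg (k : nat) : set Om := gr_deg (g := Om) k.

Definition calc_inv : set Om := [set w | sc_coact Om w = 1 *t w].

Definition calc_inv_deg (k : nat) : set Om := calc_deg k `&` calc_inv.

Definition strongly_finite_dim : Prop := exists n, has_dim calc_inv n.

Definition calculus_dim (N : nat) : Prop :=
  (exists2 w, calc_deg N w & w <> 0) /\
  forall k w, (N < k)%N -> calc_deg k w -> w = 0.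

Definition nondegenerate_calculus (N : nat) : Prop :=
  forall k w, (k <= N)%N -> calc_deg k w ->
    (forall w', calc_deg (N - k) w' -> w' * w = 0) -> w = 0.

(* The element of [H] identified with a degree-zero [w]; arbitrary junk in    *)
(* other degrees.                                                             *)
Definition to_alg (w : Om) : H := xget 0 [set a | iota a = w].

Lemma to_algK (a : H) : to_alg (iota a) = a.
Proof. by rewrite /to_alg; case: xgetP => [x _ /sc_emb_inj//|/(_ a)/(_ erefl)]. Qed.

Record is_inner_product (ip : Om -> Om -> R[i]) : Prop := {
  ip_linear : forall (c : R[i]) x y z, ip (c *: x + y) z = c * ip x z + ip y z;
  ip_conj : forall x y, ip y x = (ip x y)^*;
  ip_ge0 : forall x, 0 <= ip x x;
  ip_eq0 : forall x, ip x x = 0 -> x = 0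
}.

Definition graded_ip (ip : Om -> Om -> R[i]) : Prop :=
  forall k l x y, k <> l -> calc_deg k x -> calc_deg l y -> ip x y = 0.

Definition left_invariant_ip (h : H -> R[i]) (ip : Om -> Om -> R[i]) : Prop :=
  forall (a b : H) (w e : Om), calc_inv w -> calc_inv e ->
    ip (iota a * w) (iota b * e) = h (star b * a) * ip w e.

Definition volume_element (ip : Om -> Om -> R[i]) (N : nat) (theta : Om) : Prop :=
  [/\ calc_inv_deg N theta, gr_star theta = theta, theta <> 0 & ip theta theta = 1].

Definition is_integral (h : H -> R[i]) (N : nat) (theta : Om)
    (itg : {scalar Om}) : Prop :=
  (forall k w, (k < N)%N -> calc_deg k w -> itg w = 0) /\
  (forall a : H, itg (iota a * theta) = h a).

Definition is_twist (itg : Om -> R[i]) (sigma : {lrmorphism Om -> Om}) : Prop :=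
  [/\ bijective sigma,
      forall k w, calc_deg k w -> calc_deg k (sigma w),
      forall w, sigma (d w) = d (sigma w) &
      forall k l w w', calc_deg k w -> calc_deg l w' ->
        itg (w' * w) = (-1) ^+ (k * l) * itg (sigma w * w')].

End Calculus.

Arguments calc_deg {R H} Om k _.
Arguments calc_inv {R H} Om _.
Arguments calc_inv_deg {R H} Om k _.

(* Main.v *)
From HB Require Import structures.
Require Import Defs.
From mathcomp Require Import all_boot all_order all_algebra.
From mathcomp Require Import all_classical all_reals all_analysis.
From mathcomp Require Import complex.
From mathcomp Require Import spectral sesquilinear ring.

(* Let v be a unitary corepresentation of H and F the Gram matrix of the      *)
(* columns of v for a |-> h(a a^* ), which intertwines v and S^2 v.           *)
(* Conjugation of theta by v gives theta v = v K theta for a scalar matrix K, *)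
(* and the two strong invariance identities of h give h(b F v) = h(v b) M, so *)
(* the twist acts by sigma(v) = F^-1 v D with D = M K.  Writing the positive  *)
(* matrix F as sum_r l_r x_r^* x_r, one finds                                 *)
(*   sum_r l_r h((x_r v y)^* sigma(x_r v y)) = y^* D y,                       *)
(* hence h(a^* sigma(a)) >= 0 forces D to be positive definite.  On the       *)
(* left-invariant matrices v^* dv and v^* eta v (where sigma eta = c eta)     *)
(* sigma acts as W |-> D^-1 W D and W |-> c D^-1 W D, so a unitary            *)
(* diagonalising D exhibits left-invariant eigenvectors of sigma with         *)
(* positive eigenvalues, and products of such eigenvectors span Om_inv.  An   *)
(* inner product for which a homogeneous basis of positive eigenvectors is    *)
(* orthonormal over h is the required one.                                    *)

Set Implicit Arguments.
Unset Strict Implicit.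
Unset Printing Implicit Defensive.

Import Order.TTheory GRing.Theory Num.Theory.
Local Open Scope classical_set_scope.
Local Open Scope ring_scope.

(** Let s be the restriction of sigma to H. At a form a of degree 0 the inner product gives (sigma a
    | a) = h(star a * s a) (1 | 1), which settles one direction. For the other, it suffices to find
    a basis of the left-invariant forms made of homogeneous eigenvectors of sigma with positive
    eigenvalues lambda_i. Declaring it orthonormal over h turns (sigma w | w) into the sum of the
    lambda_i h(star w_i * s w_i), where the w_i in H are the coordinates of w.

    The basis comes from matrix coefficients. [haar_modular] and [top_form_corep] convert the
    twisted trace property of the integral into F s(v) = v D ([twist_corep]), and the hypothesis on
    h makes D positive ([twist_corep_positive]). For a matrix of forms that transforms like v and is
    twisted by F and c D, [covariant_pos_span] diagonalises sigma on its invariant part. Applied to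
    dv and to eta v, through [equivariant_pos_span], this gives [d_emb_pos_span] and
    [eigen_mulr_pos_span]. Since H and dH generate the calculus, every form is an H-combination of
    positive eigenvectors ([deg_pos_span]). Projecting to invariant forms gives [calc_inv_span],
    from which [twisted_coordinates] extracts the basis. *)

(** * Spans, linear independence and bases *)

Section Span.
Context (K : fieldType) (V : lmodType K).
Implicit Types (S P : set V).

Lemma lspan_lin S (c : K) x y : lspan S x -> lspan S y -> lspan S (c *: x + y).
Proof.
move=> [s [sS ->]] [t [tS ->]].
exists ([seq (c * p.1, p.2) | p <- s] ++ t); split.
  move=> p; rewrite mem_cat => /orP[/mapP[q qs ->]|]; [exact: (sS q) | exact: (tS p)].
rewrite big_cat big_map scaler_sumr; congr (_ + _).
by apply: eq_bigr => p _; rewrite scalerA.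
Qed.

Lemma sub_lspan S : S `<=` lspan S.
Proof.
move=> x Sx; exists [:: (1, x)]; split; last by rewrite big_seq1 scale1r.
by move=> p; rewrite inE => /eqP ->.
Qed.

Lemma lspan0 S : lspan S 0.
Proof. by exists [::]; rewrite big_nil. Qed.

Lemma lspan_min S P : P 0 -> (forall (c : K) x y, P x -> P y -> P (c *: x + y)) ->
  S `<=` P -> lspan S `<=` P.
Proof.
move=> P0 Plin SP x [s [sS ->]]; elim: s sS => [|p s IHs] sS.
  by rewrite big_nil.
rewrite big_cons; apply: Plin; first by apply/SP/sS; rewrite inE eqxx.
by apply: IHs => q qs; apply: sS; rewrite inE qs orbT.
Qed.

Lemma lspanZ S (c : K) x : lspan S x -> lspan S (c *: x).
Proof. by move=> Sx; rewrite -[_ *: _]addr0; apply: lspan_lin => //; exact: lspan0. Qed.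

Lemma lspanD S x y : lspan S x -> lspan S y -> lspan S (x + y).
Proof. by move=> Sx Sy; rewrite -[x]scale1r; apply: lspan_lin. Qed.

Lemma lspan_sum S (I : Type) (r : seq I) (A : pred I) (F : I -> V) :
  (forall i, A i -> lspan S (F i)) -> lspan S (\sum_(i <- r | A i) F i).
Proof.
by move=> SF; elim/big_rec: _ => [|i x Ai Sx]; [exact: lspan0 | exact/lspanD/Sx/SF].
Qed.

Lemma lspan_sub S T : S `<=` lspan T -> lspan S `<=` lspan T.
Proof. by apply: lspan_min => [|c x y]; [exact: lspan0 | exact: lspan_lin]. Qed.

Lemma lspan_rangeP n (b : 'I_n -> V) x :
  lspan (range b) x -> exists c : 'I_n -> K, x = \sum_i c i *: b i.
Proof.
move: x; apply: lspan_min.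
- by exists (fun=> 0); rewrite big1 // => i _; rewrite scale0r.
- move=> e x y [cx ->] [cy ->]; exists (fun i => e * cx i + cy i).
  rewrite scaler_sumr -big_split; apply: eq_bigr => i _.
  by rewrite /= scalerDl scalerA.
move=> _ [i _ <-]; exists (fun k => (k == i)%:R).
rewrite (bigD1 i) //= eqxx scale1r big1 ?addr0 // => k /negPf ->.
by rewrite scale0r.
Qed.

(** If m > n, the m x n matrix of coefficients has a nonzero left kernel vector, which is a linear
    relation between the e_i. *)
Lemma lin_indep_leq m n (e : 'I_m -> V) (b : 'I_n -> V) :
  lin_indep e -> (forall i, lspan (range b) (e i)) -> (m <= n)%N.
Proof.
move=> e_free eb; have [A eE] := choice (fun i => lspan_rangeP (eb i)).
rewrite leqNgt; apply/negP => mn.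
pose B := \matrix_(i < m, j < n) A i j.
have kB : kermx B != 0.
  rewrite -mxrank_eq0 mxrank_ker subn_eq0 -ltnNge.
  exact: leq_ltn_trans (rank_leq_col _) mn.
have /rowV0Pn[x xk x0] := kB.
have xB : x *m B = 0 by exact/sub_kermxP.
case/eqP: x0; apply/rowP => k; rewrite [RHS]mxE; move: k.
apply: (e_free (fun k => x 0 k)).
under eq_bigr do rewrite eE scaler_sumr.
rewrite exchange_big big1 //= => j _.
under eq_bigr do rewrite scalerA.
rewrite -scaler_suml; have /rowP/(_ j) := xB; rewrite !mxE => xB0.
by rewrite (_ : \sum_i _ = 0) ?scale0r // -[RHS]xB0; apply: eq_bigr => k _; rewrite mxE.
Qed.

(** An independent family in E of maximal length spans, since a vector of E outside its span could
    be appended. The basis lies in E itself, so that it can later be made of homogeneous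
    eigenvectors. *)
Lemma basis_in_spanning_set (E : set V) n : has_dim (lspan E) n ->
  exists m (b : 'I_m -> V),
    [/\ lin_indep b, forall i, E (b i) & lspan E = lspan (range b)].
Proof.
move=> [b0 [_ EE]].
pose P m := `[< exists b : 'I_m -> V, lin_indep b /\ forall i, E (b i) >].
have P0 : exists m, P m.
  by exists 0; apply/asboolP; exists (fun _ => 0); split => [c _ []|[]].
have Pn m : P m -> (m <= n)%N.
  move=> /asboolP[b [bfree bE]]; apply: (@lin_indep_leq _ _ b b0) => // i.
  by rewrite -EE; apply: sub_lspan.
case: (ex_maxnP P0 Pn) => m /asboolP[b [bfree bE]] mmax.
exists m, b; split=> //; rewrite eqEsubset; split; last first.
  by apply: lspan_sub => _ [i _ <-]; exact: sub_lspan.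
apply: lspan_sub => x Ex; apply: contrapT => nbx.
suff /mmax : P m.+1 by rewrite ltnn.
(* The family [b] with [x] appended at the last index. *)
apply/asboolP; exists (fun i => oapp b x (unlift ord_max i)); split; last first.
  by move=> i; case: unliftP => [j _|_] /=.
have wid (i : 'I_m) : lift ord_max i = widen_ord (leqnSn m) i.
  by apply: val_inj; rewrite /= /bump leqNgt ltn_ord.
move=> c; rewrite big_ord_recr /= unlift_none /=.
under eq_bigr do rewrite -wid liftK /=.
move=> c0.
have cmax : c ord_max = 0.
  apply/eqP/negP => /negP cm; apply: nbx.
  have -> : x = \sum_(i < m) (- (c ord_max)^-1 * c (lift ord_max i)) *: b i.
    under eq_bigr do rewrite -scalerA.
    rewrite -scaler_sumr; move: c0 => /eqP; rewrite addr_eq0 => /eqP ->.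
    by rewrite scalerN scaleNr opprK scalerA mulVf ?scale1r.
  by apply: lspan_sum => i _; apply/lspanZ/sub_lspan; exists i.
move: c0; rewrite cmax scale0r addr0 => /bfree cl i.
by case: (unliftP ord_max i) => [j ->|->].
Qed.

End Span.

(** * Left inverses of linear injections and dual families *)

Section Retraction.
Context (K : fieldType) (U V : lmodType K).

(** A maximal graph of a partial linear map V -> U extending the inverse of j is total. *)
Lemma linear_retraction (j : {linear U -> V}) : injective j ->
  exists r : {linear V -> U}, cancel j r.
Proof.
move=> jinj.
pose P (M : set (V * U)) :=
  [/\ forall (c : K) p q, M p -> M q -> M (c *: p.1 + q.1, c *: p.2 + q.2),
      forall u, M (j u, u) & forall u, M (0, u) -> u = 0].
pose G0 := [set p : V * U | p.1 = j p.2].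
have PG0 : P G0.
  split=> [c p q -> ->|u|u] //; rewrite /G0 /=; first by rewrite linearP.
  by rewrite -{1}(linear0 j) => /jinj.
(* [G0] is adjoined to every member because the union of the empty chain is empty and would not
   contain the graph of the inverse of j. *)
have [M [PM Mmax]] : exists A, P (G0 `|` A) /\ forall B, A `<` B -> ~ P (G0 `|` B).
  apply: Zorn_bigcup => F FP Ftot.
  have [[X0 FX0]|F0] := pselect (exists X, F X); last first.
    rewrite (_ : \bigcup_(X in F) X = set0) ?setU0 //.
    by rewrite eqEsubset; split=> // x [X FX _]; case: F0; exists X.
  have inX p : (G0 `|` \bigcup_(X in F) X) p -> exists2 X, F X & (G0 `|` X) p.
    by case=> [Gp|[X FX Xp]]; [exists X0 => //; left|exists X => //; right].
  have outX X p : F X -> (G0 `|` X) p -> (G0 `|` \bigcup_(X in F) X) p.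
    by move=> FX [Gp|Xp]; [left|right; exists X].
  split=> [c p q /inX[X FX Xp] /inX[Y FY Yq]|u|u /inX[X FX Xu]].
  - have [XY|YX] := Ftot _ _ FX FY.
      apply: (outX Y) => //; have [+ _ _] := FP _ FY; apply=> //.
      by apply: setUS Xp.
    apply: (outX X) => //; have [+ _ _] := FP _ FX; apply=> //.
    by apply: setUS Yq.
  - by left.
  - by have [_ _] := FP _ FX; apply.
set N := G0 `|` M in PM; have [Nlin Nj N0] := PM.
have N00 : N (0, 0) by rewrite -{1}(linear0 j); exact: Nj.
have NZ c p : N p -> N (c *: p.1, c *: p.2).
  by move=> Np; have := Nlin c _ _ Np N00; rewrite /= !addr0.
have Nuniq v u u' : N (v, u) -> N (v, u') -> u = u'.
  move=> Nu Nu'; apply/eqP; rewrite -subr_eq0; apply/eqP; apply: N0.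
  by have := Nlin (-1) _ _ Nu' Nu; rewrite /= !scaleN1r addNr addrC.
(* Were v outside the domain, sending v to 0 would give the strictly larger admissible graph [B]. *)
have Ntot v : exists u, N (v, u).
  apply: contrapT => nv.
  pose B := [set p | exists (c : K) q, N q /\ p = (c *: v + q.1, q.2)].
  have NB : N `<=` B.
    by move=> p Np; exists 0, p; rewrite scale0r add0r; case: p Np.
  have GB : G0 `|` B = B by apply/setUidr => p Gp; apply: NB; left.
  apply: (Mmax B).
    split=> [p Mp|BM]; first by apply: NB; right.
    by apply: nv; exists 0; right; apply: BM; exists 1, (0, 0); rewrite scale1r addr0.
  rewrite GB; split=> [c p q [e [p' [Np' ->]]] [f [q' [Nq' ->]]]|u|u].
  - exists (c * e + f), (c *: p'.1 + q'.1, c *: p'.2 + q'.2); split.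
      exact: Nlin.
    by rewrite /= scalerDr scalerDl scalerA addrACA.
  - exact/NB/Nj.
  - move=> [c [q [Nq [/esym/eqP + ->]]]].
    have [->|c0] := eqVneq c 0.
      by rewrite scale0r add0r => /eqP q0; apply: N0; rewrite -q0; case: (q) Nq.
    rewrite addr_eq0 => /eqP cv; exfalso; apply: nv; exists ((- c^-1) *: q.2).
    have := NZ (- c^-1) q Nq; congr (N (_, _)).
    by rewrite scaleNr -scalerN -cv scalerA mulVf ?scale1r.
have [r rP] := choice Ntot.
have rlin : linear r.
  by move=> c x y; apply: (Nuniq (c *: x + y)) (rP _) (Nlin _ _ _ (rP x) (rP y)).
pose rL := GRing.isLinear.Build K V U _ r rlin.
exists (HB.pack_for {linear V -> U} r rL) => u /=.
exact: Nuniq (rP (j u)) (Nj u).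
Qed.

End Retraction.

(** The family embeds K^n into V; the coordinates of a retraction of this embedding are the dual
    functionals. *)
Lemma dual_family (K : fieldType) (V : lmodType K) n (b : 'I_n -> V) : lin_indep b ->
  exists c : 'I_n -> {scalar V}, forall i k, c i (b k) = (i == k)%:R.
Proof.
move=> bfree; pose j (x : 'rV[K]_n) := \sum_i x 0 i *: b i.
have jlin : linear j.
  move=> e x y; rewrite /j scaler_sumr -big_split; apply: eq_bigr => i _.
  by rewrite !mxE scalerDl scalerA.
pose jL := HB.pack_for {linear 'rV[K]_n -> V} j (GRing.isLinear.Build K _ _ _ j jlin).
have jinj : injective jL.
  move=> x y xy; apply/rowP => i; apply/eqP; rewrite -subr_eq0.
  apply/eqP; have := bfree (fun i => x 0 i - y 0 i); apply.
  under eq_bigr do rewrite scalerBl.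
  by rewrite sumrB; apply/eqP; rewrite subr_eq0; apply/eqP.
have [r rK] := linear_retraction jinj.
have clin i : linear (fun w => r w 0 i : K^o).
  by move=> e x y; rewrite linearP !mxE.
exists (fun i => HB.pack_for {scalar V} (fun w => r w 0 i)
  (GRing.isLinear.Build K V K^o _ (fun w => r w 0 i) (clin i))) => i k /=.
have -> : b k = jL (delta_mx 0 k).
  rewrite /= /j (bigD1 k) //= mxE !eqxx scale1r big1 ?addr0 // => l lk.
  by rewrite mxE (negPf lk) andbF scale0r.
by rewrite rK mxE eqxx.
Qed.

(** * Positive sesquilinear forms and their diagonalisation *)

Section Spectral.
Context (C : numClosedFieldType).
Local Open Scope sesquilinear_scope.

Definition positive_form n (A : 'M[C]_n) : Prop :=
  forall x : 'I_n -> C, 0 <= \sum_i \sum_j (x i)^* * A i j * x j.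

(** Polarisation: the form is real at e_i + e_j and at e_i + i e_j, and the two resulting equations
    determine A j i. *)
Lemma positive_form_hermitian n (A : 'M[C]_n) : positive_form A ->
  forall i j, A j i = (A i j)^*.
Proof.
move=> Apos.
pose B (x y : 'I_n -> C) := \sum_i \sum_j (x i)^* * A i j * y j.
have BDl x x' y : B (fun i => x i + x' i) y = B x y + B x' y.
  rewrite /B -big_split; apply: eq_bigr => i _; rewrite -big_split.
  by apply: eq_bigr => j _; rewrite /= rmorphD !mulrDl.
have BDr x y y' : B x (fun i => y i + y' i) = B x y + B x y'.
  rewrite /B -big_split; apply: eq_bigr => i _; rewrite -big_split.
  by apply: eq_bigr => j _; rewrite /= mulrDr.
have BZl c x y : B (fun i => c * x i) y = c^* * B x y.
  rewrite /B mulr_sumr; apply: eq_bigr => i _; rewrite mulr_sumr.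
  by apply: eq_bigr => j _; rewrite /= rmorphM !mulrA.
have BZr c x y : B x (fun i => c * y i) = c * B x y.
  rewrite /B mulr_sumr; apply: eq_bigr => i _; rewrite mulr_sumr.
  by apply: eq_bigr => j _; rewrite /= mulrCA.
have Breal x : (B x x)^* = B x x by apply/CrealP/ger0_real/Apos.
pose e i : 'I_n -> C := fun k => (k == i)%:R.
have Be i j : B (e i) (e j) = A i j.
  rewrite /B (bigD1 i) //= (bigD1 j) //= /e !eqxx rmorph1 mul1r mulr1.
  rewrite big1 ?addr0; last by move=> k /negPf ->; rewrite mulr0.
  rewrite big1 ?addr0 // => k /negPf ->; rewrite big1 // => l _.
  by rewrite rmorph0 !mul0r.
have sym x y : (B x y)^* + (B y x)^* = B x y + B y x.
  have := Breal (fun i => x i + y i); rewrite !BDl !BDr.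
  by rewrite !rmorphD /= !Breal -!addrA => /addrI; rewrite !addrA => /addIr.
move=> i j; have E1 := sym (e i) (e j).
have := sym (e i) (fun k => 'i * e j k).
rewrite !(BZl, BZr) !Be in E1 *; rewrite !rmorphM /= !(conjCi, rmorphN) /=.
set a := A i j in E1 *; set b := A j i in E1 *.
rewrite ?conjCi ?opprK !mulNr -!mulrN -!mulrDr => E2; have {}E2 := mulfI (neq0Ci C) E2.
apply: (mulIf (x := 2)); first by rewrite pnatr_eq0.
transitivity ((a + b) - (a - b)); first by ring.
by rewrite -E1 -E2; ring.
Qed.

(** A Hermitian matrix is unitarily diagonalisable, and each l k is the value of the form at the
    conjugate of row k of U. *)
Lemma positive_form_spectral n (A : 'M[C]_n) : positive_form A ->
  exists (U : 'M[C]_n) (l : 'I_n -> C),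
    [/\ U \is unitarymx, forall i, 0 <= l i &
        A = U ^t* *m diag_mx (\row_i l i) *m U].
Proof.
move=> Apos.
have /orthomx_spectralP AE : A \is normalmx.
  apply: hermitian_normalmx; apply/is_hermitianmxP; rewrite expr0 scale1r.
  by apply/matrixP => i j; rewrite !mxE; exact: positive_form_hermitian.
exists (spectralmx A), (spectral_diag A 0); have Uu := spectral_unitarymx A.
have AE' : A = spectralmx A ^t* *m diag_mx (\row_i spectral_diag A 0 i) *m spectralmx A.
  rewrite -invmx_unitary // {1}AE; congr (_ *m diag_mx _ *m _).
  by apply/rowP => i; rewrite mxE.
split=> // k; set U := spectralmx A in Uu AE' *.
have := Apos (fun i => (U k i)^*).
have -> : \sum_i \sum_j (U k i)^*^* * A i j * (U k j)^* = (U *m A *m U ^t*) k k.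
  rewrite !mxE exchange_big; apply: eq_bigr => j _.
  rewrite !mxE mulr_suml; apply: eq_bigr => i _; by rewrite conjCK.
rewrite {1}AE' !mulmxA (unitarymxP _) // mul1mx -mulmxA (unitarymxP _) // mulmx1.
by rewrite !mxE eqxx mulr1n.
Qed.

End Spectral.

(** * Tensor products of linear maps *)

Lemma id_linear (K : fieldType) (V : lmodType K) : linear (id : V -> V).
Proof. by []. Qed.

Lemma linear_fun0 (K : fieldType) (U V : lmodType K) (f : U -> V) : linear f -> f 0 = 0.
Proof. by move=> /(_ (-1) 0 0); rewrite scaler0 addr0 scaleN1r addNr. Qed.

Lemma linear_funZ (K : fieldType) (U V : lmodType K) (f : U -> V) : linear f ->
  forall c x, f (c *: x) = c *: f x.
Proof. by move=> fl c x; have := fl c x 0; rewrite !addr0 linear_fun0 ?addr0. Qed.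

Section TensorMap.
Context (K : fieldType) (A B A' B' : lmodType K).

Lemma tpureDl (x x' : A) (y : B) : (x + x') *t y = x *t y + x' *t y.
Proof. by have := (tpure_bilin A B).1 y 1 x x'; rewrite !scale1r. Qed.

Lemma tpureDr (x : A) (y y' : B) : x *t (y + y') = x *t y + x *t y'.
Proof. by have := (tpure_bilin A B).2 x 1 y y'; rewrite !scale1r. Qed.

Lemma tpureZr (c : K) (x : A) (y : B) : x *t (c *: y) = c *: (x *t y).
Proof. exact: bilinZr (tpure_bilin A B) c x y. Qed.

Lemma tpure0l (y : B) : (0 : A) *t y = 0.
Proof. exact: bilin0l (tpure_bilin A B) y. Qed.

Lemma tpure0r (x : A) : x *t (0 : B) = 0.
Proof. exact: bilin0r (tpure_bilin A B) x. Qed.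

Lemma tpure_suml (I : Type) (r : seq I) (P : pred I) (F : I -> A) (y : B) :
  (\sum_(i <- r | P i) F i) *t y = \sum_(i <- r | P i) F i *t y.
Proof.
apply: (big_morph (fun x => x *t y)) => [x x'|]; first exact: tpureDl.
exact: tpure0l.
Qed.

Lemma tpure_sumr (I : Type) (r : seq I) (P : pred I) (x : A) (F : I -> B) :
  x *t (\sum_(i <- r | P i) F i) = \sum_(i <- r | P i) x *t F i.
Proof.
apply: (big_morph (fun y => x *t y)) => [y y'|]; first exact: tpureDr.
exact: tpure0r.
Qed.

Lemma tlift_sum (V : lmodType K) (f : A -> B -> V) : bilin f ->
  forall (I : Type) (r : seq I) (P : pred I) (F : I -> tensor A B),
  tlift f (\sum_(i <- r | P i) F i) = \sum_(i <- r | P i) tlift f (F i).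
Proof.
move=> bf I r P F; apply: (big_morph (tlift f)) => [x x'|]; last exact: tlift0.
exact: (tliftD bf).
Qed.

Context (f : A -> A') (g : B -> B') (fl : linear f) (gl : linear g).

Lemma tmap_bilin : bilin (fun a b => f a *t g b).
Proof.
by split=> *; rewrite ?fl ?gl; [apply: (tpure_bilin _ _).1|apply: (tpure_bilin _ _).2].
Qed.

Lemma tmap_pure a b : tmap f g (a *t b) = f a *t g b.
Proof. exact: tlift_pure tmap_bilin. Qed.

Lemma tmap_linear (c : K) x y :
  tmap f g (c *: x + y) = c *: tmap f g x + tmap f g y.
Proof. exact: tlift_linear tmap_bilin c x y. Qed.

Lemma tmap_sum (I : Type) (r : seq I) (P : pred I) (F : I -> tensor A B) :
  tmap f g (\sum_(i <- r | P i) F i) = \sum_(i <- r | P i) tmap f g (F i).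
Proof. exact: tlift_sum tmap_bilin _ _ _ _. Qed.

End TensorMap.

(** Over a field both injections have linear left inverses, whose tensor product is a left inverse
    of [tmap f g]. *)
Lemma tmap_inj (K : fieldType) (A B A' B' : lmodType K)
  (f : {linear A -> A'}) (g : {linear B -> B'}) :
  injective f -> injective g -> injective (tmap f g).
Proof.
move=> /linear_retraction[r rK] /linear_retraction[s sK].
apply: (can_inj (g := tmap r s)).
have rs := tmap_linear (linearP r) (linearP s).
have fg := tmap_linear (linearP f) (linearP g).
apply: tlift_uniq => [c x y|//|a b]; first by rewrite fg rs.
by rewrite (tmap_pure (linearP f) (linearP g)) tmap_pure ?rK ?sK //; exact: linearP.
Qed.

Lemma scalerMM (K : comNzRingType) (A : algType K) (c e : K) (a b : A) :
  (c *: a) * (e *: b) = (c * e) *: (a * b).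
Proof. by rewrite -scalerAl -scalerAr scalerA. Qed.

Lemma scalar_functionalZ (K : fieldType) (V : lmodType K) (f : {scalar V}) (c : K) x :
  f (c *: x) = c * f x.
Proof. exact: linearZ. Qed.

(** * Unitary corepresentations and scalar matrices *)

Section Corepresentations.
Context (R : realType) (H : hopf_star_algebra R).
Local Notation C := R[i].

Lemma star0 (A : starAlgType R) : star (0 : A) = 0.
Proof. by apply: (addrI (star 0)); rewrite -starD !addr0. Qed.

Lemma star_sum (A : starAlgType R) (I : Type) (r : seq I) (P : pred I) (F : I -> A) :
  star (\sum_(i <- r | P i) F i) = \sum_(i <- r | P i) star (F i).
Proof. apply: (big_morph (@star R A)) => [x y|]; [exact: starD|exact: star0]. Qed.

Definition adjmx (A : starAlgType R) m n (v : 'M[A]_(m, n)) : 'M[A]_(n, m) :=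
  \matrix_(i, j) star (v j i).

Definition unitary_corep n (v : 'M[H]_n) : Prop :=
  [/\ adjmx v *m v = 1%:M, v *m adjmx v = 1%:M &
      forall i j, comul H (v i j) = \sum_k v i k *t v k j].

(** All entries of an irreducible unitary representation of G lie in the range of [j], so it lifts
    entrywise to H. Unitarity and the coproduct formula hold for the lift because they hold after
    applying injective maps. *)
Lemma span_corep_coefs (G : compact_quantum_group R) : associated_hopf G H ->
  forall a : H, lspan [set x | exists n (v : 'M[H]_n),
    unitary_corep v /\ exists i j, x = v i j] a.
Proof.
move=> [j [jinj jstar jrange jcomul]] a; set S := (X in lspan X).
suff [b [/jinj-> //]] : exists b, j a = j b /\ lspan S b.
have : lspan (@matrix_element R G) (j a) by rewrite -jrange; exists a.
move: (j a); apply: lspan_min => [|c x y [b [-> Sb]] [b' [-> Sb']]|x].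
- by exists 0; rewrite linear0; split=> //; exact: lspan0.
- by exists (c *: b + b'); rewrite linearP; split=> //; exact: lspan_lin.
move=> [n [u [uunit uirr [k [l ->]]]]].
have uj : forall p : 'I_n * 'I_n, exists b, j b = u p.1 p.2.
  move=> p; have [b _ bE] : range j (u p.1 p.2); last by exists b.
  by rewrite jrange; apply: sub_lspan; exists n, u; split => //; exists p.1, p.2.
have [v0 v0E] := choice uj; pose v : 'M[H]_n := \matrix_(p, q) v0 (p, q).
have vE p q : j (v p q) = u p q by rewrite mxE v0E.
exists (v k l); split; rewrite ?vE //.
apply: sub_lspan; exists n, v; split; last by exists k, l.
have [usu uus ucomul] := uunit; split.
- apply/matrixP => p q; apply: jinj; move/matrixP/(_ p q): usu.
  rewrite !mxE rmorph_sum rmorph_nat => <-; apply: eq_bigr => r _.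
  by rewrite rmorphM /= vE !mxE jstar v0E.
- apply/matrixP => p q; apply: jinj; move/matrixP/(_ p q): uus.
  rewrite !mxE rmorph_sum rmorph_nat => <-; apply: eq_bigr => r _.
  by rewrite rmorphM /= vE !mxE jstar v0E.
move=> p q; apply: (tmap_inj jinj jinj); apply: (mint_inj (cq_incl2P G)).
rewrite jcomul vE ucomul (tmap_sum (linearP j) (linearP j)) linear_sum.
apply: eq_bigr => r _.
by rewrite (tmap_pure (linearP j) (linearP j)) -!vE.
Qed.

End Corepresentations.

Section ScalarMatrices.
Context (K : comNzRingType) (A : algType K).
Local Notation "P ^e" := (map_mx (in_alg A) P) (at level 8, format "P ^e").

Lemma mul_scalar_mxE m1 m2 m3 (P : 'M[K]_(m1, m2)) (B : 'M[A]_(m2, m3)) i j :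
  (P^e *m B) i j = \sum_k P i k *: B k j.
Proof. by rewrite mxE; apply: eq_bigr => k _; rewrite mxE -scalerAl mul1r. Qed.

Lemma mul_mx_scalarE m1 m2 m3 (B : 'M[A]_(m1, m2)) (P : 'M[K]_(m2, m3)) i j :
  (B *m P^e) i j = \sum_k P k j *: B i k.
Proof. by rewrite mxE; apply: eq_bigr => k _; rewrite mxE -scalerAr mulr1. Qed.

End ScalarMatrices.

(** * Gram matrices of the Haar integral, strong invariance and modularity *)

Section Haar.
Context (R : realType) (H : hopf_star_algebra R).
Context (h : {scalar H}) (h_haar : is_haar h).
Context (n : nat) (v : 'M[H]_n) (vP : unitary_corep v).
Local Notation C := R[i].
Local Notation "A ^e" := (map_mx (in_alg H) A) (at level 8, format "A ^e").

Definition definite_form m (A : 'M[C]_m) : Prop :=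
  forall x : 'I_m -> C, \sum_i \sum_j (x i)^* * A i j * x j = 0 -> forall i, x i = 0.

Lemma definite_form_unit m (A : 'M[C]_m) : definite_form A -> A \in unitmx.
Proof.
move=> Adef; rewrite -row_free_unit -kermx_eq0; apply/rowV0P => x /sub_kermxP xA.
apply/rowP => i; rewrite mxE -[x 0 i]conjCK; apply/eqP.
rewrite fmorph_eq0; apply/eqP; apply: (Adef (fun k => (x 0 k)^*)).
rewrite exchange_big big1 // => j _; rewrite -mulr_suml.
under eq_bigr do rewrite conjCK.
by move/rowP/(_ j): xA; rewrite !mxE => ->; rewrite mul0r.
Qed.

(** Gram matrices of the columns of v for h(b * star a) and of its rows for h(star a * b). The two
    orders of multiplication serve the inverses of v on either side over the opposite algebra. *)
Definition gram_col : 'M[C]_n := \matrix_(m, k) \sum_i h (v i k * star (v i m)).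
Definition gram_row : 'M[C]_n := \matrix_(i, l) \sum_j h (star (v i j) * v l j).

Lemma gram_colE (x : 'I_n -> C) :
  \sum_i \sum_j (x i)^* * gram_col i j * x j =
  \sum_i h ((\sum_k x k *: v i k) * star (\sum_k x k *: v i k)).
Proof.
transitivity (\sum_i \sum_j \sum_k (x i)^* * h (v k j * star (v k i)) * x j).
  by apply: eq_bigr => i _; apply: eq_bigr => j _; rewrite mxE mulr_sumr mulr_suml.
under eq_bigr do rewrite exchange_big /=.
rewrite exchange_big; apply: eq_bigr => i _ /=; rewrite exchange_big.
rewrite mulr_suml linear_sum; apply: eq_bigr => j _ /=.
rewrite star_sum mulr_sumr linear_sum; apply: eq_bigr => k _ /=.
by rewrite starZ scalerMM scalar_functionalZ; ring.
Qed.

Lemma gram_rowE (x : 'I_n -> C) :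
  \sum_i \sum_j (x i)^* * gram_row i j * x j =
  \sum_j h (star (\sum_k x k *: v k j) * (\sum_k x k *: v k j)).
Proof.
transitivity (\sum_i \sum_j \sum_k (x i)^* * h (star (v i k) * v j k) * x j).
  by apply: eq_bigr => i _; apply: eq_bigr => j _; rewrite mxE mulr_sumr mulr_suml.
under eq_bigr do rewrite exchange_big /=.
rewrite exchange_big; apply: eq_bigr => k _ /=.
rewrite star_sum mulr_suml linear_sum; apply: eq_bigr => i _ /=.
rewrite mulr_sumr linear_sum; apply: eq_bigr => j _ /=.
by rewrite starZ scalerMM scalar_functionalZ mulrAC.
Qed.

Lemma gram_col_positive : positive_form gram_col.
Proof.
move=> x; rewrite gram_colE sumr_ge0 // => i _.
by have := haar_ge0 h_haar (star (\sum_k x k *: v i k)); rewrite starK.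
Qed.

Lemma adjmx_mul_coef i j : \sum_k star (v k i) * v k j = (i == j)%:R.
Proof.
have [/matrixP/(_ i j) + _ _] := vP; rewrite !mxE => <-.
by apply: eq_bigr => k _; rewrite mxE.
Qed.

Lemma mul_adjmx_coef i j : \sum_k v i k * star (v j k) = (i == j)%:R.
Proof.
have [_ /matrixP/(_ i j) + _] := vP; rewrite !mxE => <-.
by apply: eq_bigr => k _; rewrite mxE.
Qed.

Lemma comul_coef i j : comul H (v i j) = \sum_k v i k *t v k j.
Proof. by have [_ _] := vP. Qed.

Lemma comul_star_coef i j :
  comul H (star (v i j)) = \sum_k star (v i k) *t star (v k j).
Proof.
rewrite comul_star comul_coef star_sum; apply: eq_bigr => k _.
exact: tensor_star_pure.
Qed.

(** If the form vanishes at x, faithfulness of h gives v x = 0, and then x = 0 because v is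
    unitary. *)
Lemma gram_col_unit : gram_col \in unitmx.
Proof.
apply: definite_form_unit => x /eqP; rewrite gram_colE psumr_eq0; last first.
  move=> i _; have := haar_ge0 h_haar (star (\sum_k x k *: v i k)); by rewrite starK.
move=> /allP x0 l.
have xv i : \sum_k x k *: v i k = 0.
  rewrite -[LHS](starK _) [X in star X](_ : _ = 0) ?star0 //.
  apply: (haar_faithful h_haar); rewrite starK; apply/eqP.
  exact: (x0 i (mem_index_enum i)).
have : \sum_i star (v i l) * (\sum_k x k *: v i k) = x l *: 1.
  under eq_bigr do rewrite mulr_sumr.
  rewrite exchange_big (bigD1 l) //= [X in _ + X]big1 ?addr0.
    under eq_bigr do rewrite -scalerAr.
    by rewrite -scaler_sumr adjmx_mul_coef eqxx.
  move=> k kl; under eq_bigr do rewrite -scalerAr.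
  by rewrite -scaler_sumr adjmx_mul_coef eq_sym (negPf kl) scaler0.
rewrite big1 => [/esym/eqP|i _]; last by rewrite xv mulr0.
by rewrite scaler_eq0 oner_eq0 orbF => /eqP.
Qed.

Lemma gram_row_unit : gram_row \in unitmx.
Proof.
apply: definite_form_unit => x /eqP; rewrite gram_rowE psumr_eq0; last first.
  by move=> j _; exact: haar_ge0.
move=> /allP x0 l.
have xv j : \sum_k x k *: v k j = 0.
  apply: (haar_faithful h_haar); apply/eqP.
  exact: (x0 j (mem_index_enum j)).
have : \sum_j (\sum_k x k *: v k j) * star (v l j) = x l *: 1.
  under eq_bigr do rewrite mulr_suml.
  rewrite exchange_big (bigD1 l) //= [X in _ + X]big1 ?addr0.
    under eq_bigr do rewrite -scalerAl.
    by rewrite -scaler_sumr mul_adjmx_coef eqxx.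
  move=> k kl; under eq_bigr do rewrite -scalerAl.
  by rewrite -scaler_sumr mul_adjmx_coef (negPf kl) scaler0.
rewrite big1 => [/esym/eqP|i _]; last by rewrite xv mul0r.
by rewrite scaler_eq0 oner_eq0 orbF => /eqP.
Qed.

Lemma bilin_scalel (f g : H -> H) (k : H -> C) :
  linear f -> scalar k -> bilin (fun x y => k x *: f y).
Proof.
move=> fl kl; split=> [b c x y|a c x y]; first by rewrite kl scalerDl scalerA.
by rewrite fl scalerDr !scalerA mulrC.
Qed.

Lemma bilin_scaler (f : H -> H) (k : H -> C) :
  linear f -> scalar k -> bilin (fun x y => k y *: f x).
Proof.
move=> fl kl; split=> [b c x y|a c x y]; last by rewrite kl scalerDl scalerA.
by rewrite fl scalerDr !scalerA mulrC.
Qed.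

Lemma haar_scalar : scalar h.
Proof. exact: linearP. Qed.

Lemma haar_mull_scalar a : scalar (fun x => h (a * x)).
Proof. by move=> c x y; rewrite mulrDr -scalerAr haar_scalar. Qed.

Lemma haar_mulr_scalar a : scalar (fun x => h (x * a)).
Proof. by move=> c x y; rewrite mulrDl -scalerAl haar_scalar. Qed.

(** Invariance of h at the sum over i of v_ij * star v_il, expanded by the coproduct. Multiplied by
    the inverse of the Gram matrix, it becomes [opp_invlP]. *)
Lemma haar_invr_coef j l :
  \sum_k \sum_m gram_col m k *: (v k j * star (v m l)) = gram_col l j *: 1.
Proof.
have bf := bilin_scalel id (@id_linear _ H) haar_scalar.
have := haar_invr h_haar (\sum_i v i j * star (v i l)).
rewrite !linear_sum /= (_ : (\sum_i _)%:A = gram_col l j *: 1); last by rewrite mxE.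
move=> <-; rewrite (tlift_sum bf).
under [RHS]eq_bigr do rewrite rmorphM /= comul_coef comul_star_coef mulr_suml
  (tlift_sum bf).
rewrite [RHS]exchange_big; apply: eq_bigr => k _ /=.
under [RHS]eq_bigr do rewrite mulr_sumr (tlift_sum bf).
rewrite [RHS]exchange_big; apply: eq_bigr => m _ /=.
rewrite mxE scaler_suml; apply: eq_bigr => i _.
by rewrite tpureM (tlift_pure _ _ bf).
Qed.

Lemma haar_invl_coef i l :
  \sum_k \sum_m gram_row k m *: (star (v i k) * v l m) = gram_row i l *: 1.
Proof.
have bf := bilin_scaler (@id_linear _ H) haar_scalar.
have := haar_invl h_haar (\sum_j star (v i j) * v l j).
rewrite !linear_sum /= (_ : (\sum_i _)%:A = gram_row i l *: 1); last by rewrite mxE.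
move=> <-; rewrite (tlift_sum bf).
under [RHS]eq_bigr do rewrite rmorphM /= comul_coef comul_star_coef mulr_suml
  (tlift_sum bf).
rewrite [RHS]exchange_big; apply: eq_bigr => k _ /=.
under [RHS]eq_bigr do rewrite mulr_sumr (tlift_sum bf).
rewrite [RHS]exchange_big; apply: eq_bigr => m _ /=.
rewrite mxE scaler_suml; apply: eq_bigr => j _.
by rewrite tpureM (tlift_pure _ _ bf).
Qed.

(* Plays the role of S^-1(v): a left inverse of v over the opposite algebra. *)
Definition opp_invl : 'M[H]_n := (invmx gram_col)^e *m adjmx v *m gram_col^e.

Lemma opp_invlP p j : \sum_k v k j * opp_invl p k = (j == p)%:R.
Proof.
transitivity (\sum_l invmx gram_col p l *:
    \sum_k \sum_m gram_col m k *: (v k j * star (v m l))).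
  under [RHS]eq_bigr do rewrite scaler_sumr.
  rewrite exchange_big; apply: eq_bigr => k _ /=.
  under [RHS]eq_bigr do rewrite scaler_sumr.
  rewrite exchange_big mul_mx_scalarE mulr_sumr; apply: eq_bigr => m _ /=.
  rewrite mul_scalar_mxE scaler_sumr mulr_sumr; apply: eq_bigr => l _ /=.
  by rewrite -!scalerAr [adjmx _ _ _]mxE !scalerA mulrC.
under eq_bigr do rewrite haar_invr_coef scalerA.
rewrite -scaler_suml.
have /matrixP/(_ p j) := mulVmx gram_col_unit; rewrite !mxE => ->.
by rewrite scaler_nat eq_sym.
Qed.

(** Plays the role of the transpose of S^-1(v): its transpose is a right inverse of v over the
    opposite algebra. *)
Definition opp_invr : 'M[H]_n :=
  (invmx gram_row)^e *m (\matrix_(i, j) star (v i j)) *m gram_row^e.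

Lemma opp_invrP p l : \sum_m opp_invr p m * v l m = (p == l)%:R.
Proof.
transitivity (\sum_i invmx gram_row p i *:
    \sum_k \sum_m gram_row k m *: (star (v i k) * v l m)).
  under [RHS]eq_bigr do rewrite exchange_big scaler_sumr.
  rewrite exchange_big; apply: eq_bigr => m _ /=.
  under [RHS]eq_bigr do rewrite scaler_sumr.
  rewrite exchange_big mul_mx_scalarE mulr_suml; apply: eq_bigr => k _ /=.
  rewrite mul_scalar_mxE scaler_sumr mulr_suml; apply: eq_bigr => i _ /=.
  by rewrite -!scalerAl [(\matrix_(_, _) star _) _ _]mxE !scalerA mulrC.
under eq_bigr do rewrite haar_invl_coef scalerA.
rewrite -scaler_suml.
have /matrixP/(_ p l) := mulVmx gram_row_unit; rewrite !mxE => ->.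
by rewrite scaler_nat.
Qed.

(* In Sweedler notation, (id * h)(b_1 (x) b_2 v) = S^-1(v) h(b v); obtained *)
(* by inserting [opp_invl] into the invariance of [h] at [b * v].           *)
Lemma strong_invl b p j :
  tlift (fun x y => h (y * v p j) *: x) (comul H b) =
  \sum_i h (b * v i j) *: opp_invl p i.
Proof.
have bf := bilin_scaler (@id_linear _ H) haar_scalar.
have bf' := bilin_scaler (@id_linear _ H) (haar_mulr_scalar (v p j)).
transitivity (\sum_i tlift (fun x y => h y *: x) (comul H (b * v i j)) * opp_invl p i);
  last first.
  by apply: eq_bigr => i _; rewrite (haar_invl h_haar) -scalerAl mul1r.
under eq_bigr do rewrite rmorphM /= comul_coef.
move: (comul H b); apply: tlift_uniq => [c x y|c x y|x y].
- by rewrite (tlift_linear bf').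
- rewrite scaler_sumr -big_split; apply: eq_bigr => i _ /=.
  by rewrite mulrDl -scalerAl (tlift_linear bf) mulrDl -scalerAl.
rewrite (tlift_pure _ _ bf').
transitivity (\sum_k h (y * v k j) *: (x * \sum_i v i k * opp_invl p i)).
  rewrite (bigD1 p) //= opp_invlP eqxx mulr1 big1 ?addr0 // => k kp.
  by rewrite opp_invlP (negPf kp) mulr0 scaler0.
under [LHS]eq_bigr do rewrite mulr_sumr scaler_sumr.
rewrite [LHS]exchange_big; apply: eq_bigr => i _ /=.
rewrite mulr_sumr (tlift_sum bf) mulr_suml; apply: eq_bigr => k _.
by rewrite tpureM (tlift_pure _ _ bf) -scalerAl mulrA.
Qed.

(** The mirror image of [strong_invl]: [opp_invr] is inserted into the invariance of h at v * b. *)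
Lemma strong_invr b i p :
  tlift (fun x y => h (v i p * x) *: y) (comul H b) =
  \sum_j h (v i j * b) *: opp_invr p j.
Proof.
have bf := bilin_scalel id (@id_linear _ H) haar_scalar.
have bf' := bilin_scalel id (@id_linear _ H) (haar_mull_scalar (v i p)).
transitivity (\sum_j opp_invr p j * tlift (fun x y => h x *: y) (comul H (v i j * b)));
  last first.
  by apply: eq_bigr => j _; rewrite (haar_invr h_haar) -scalerAr mulr1.
under eq_bigr do rewrite rmorphM /= comul_coef.
move: (comul H b); apply: tlift_uniq => [c x y|c x y|x y].
- by rewrite (tlift_linear bf').
- rewrite scaler_sumr -big_split; apply: eq_bigr => j _ /=.
  by rewrite mulrDr -scalerAr (tlift_linear bf) mulrDr -scalerAr.
rewrite (tlift_pure _ _ bf').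
transitivity (\sum_k h (v i k * x) *: ((\sum_j opp_invr p j * v k j) * y)).
  rewrite (bigD1 p) //= opp_invrP eqxx mul1r big1 ?addr0 // => k kp.
  by rewrite opp_invrP eq_sym (negPf kp) mul0r scaler0.
under [LHS]eq_bigr do rewrite mulr_suml scaler_sumr.
rewrite exchange_big; apply: eq_bigr => j _ /=.
rewrite mulr_suml (tlift_sum bf) mulr_sumr; apply: eq_bigr => k _.
by rewrite tpureM (tlift_pure _ _ bf) -scalerAr mulrA.
Qed.

(** Both sides are the value at t of the tensor product of f and g. *)
Lemma tlift_swap (f g : H -> C) : scalar f -> scalar g ->
  forall t : tensor H H, f (tlift (fun x y => g y *: x) t) =
                         g (tlift (fun x y => f x *: y) t).
Proof.
move=> fl gl.
have bf := bilin_scaler (@id_linear _ H) gl.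
have bg := bilin_scalel id (@id_linear _ H) fl.
have Z (k : H -> C) (kl : scalar k) c x : k (c *: x) = c * k x.
  exact: (@linear_funZ C H C^o k kl).
apply: (@tlift_uniq _ _ _ C^o) => [c x y|c x y|a b].
- by rewrite (tlift_linear bf) fl.
- by rewrite (tlift_linear bg) gl.
by rewrite !tlift_pure // !Z // mulrC.
Qed.

(** A matrix form of the modular property of h: moving v from the right of b to its left costs F and
    a scalar matrix independent of b. The two strong invariance identities are combined on the two
    legs of the coproduct of b. *)
Lemma haar_modular : exists M : 'M[C]_n, forall b k j,
  \sum_r gram_col k r * h (b * v r j) = \sum_q h (v k q * b) * M q j.
Proof.
exists (\matrix_(q, j) \sum_p \sum_r gram_col p r * h (opp_invr p q * v r j)).
move=> b k j.
pose phi a : 'M[C]_n := \matrix_(r, l) h (a * v r l).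
pose L : 'M[H]_n :=
  \matrix_(p, l) tlift (fun x y => h (y * v p l) *: x) (comul H b).
have LE : L = opp_invl *m (phi b)^e.
  apply/matrixP => p l; rewrite mul_mx_scalarE mxE strong_invl.
  by apply: eq_bigr => i _; rewrite [phi _ _ _]mxE.
(* [opp_invl] is the adjoint of v conjugated by F, so F and v cancel and scalars remain. *)
have vL : v *m (gram_col^e *m L) = (gram_col *m phi b)^e.
  rewrite LE /opp_invl !mulmxA -(mulmxA v) -map_mxM mulmxV ?gram_col_unit //.
  have [_ vv _] := vP.
  by rewrite map_mx1 mulmx1 vv mul1mx map_mxM.
have := congr1 (fun X : 'M[H]_n => h (X k j)) vL.
rewrite /= [in RHS]mxE scalar_functionalZ haar1 //.
rewrite mulr1 [in RHS]mxE; under [in RHS]eq_bigr do rewrite [phi b _ _]mxE.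
move=> <-; rewrite mxE linear_sum.
pose g p y := \sum_r gram_col p r * h (y * v r j).
have gl p : scalar (g p).
  move=> c x y; rewrite /g mulr_sumr -big_split; apply: eq_bigr => r _.
  by rewrite haar_mulr_scalar /= mulrDr mulrCA.
have gE p : (gram_col^e *m L) p j = tlift (fun x y => g p y *: x) (comul H b).
  rewrite mul_scalar_mxE /tlift /tsum.
  under eq_bigr do rewrite [L _ _]mxE /tlift /tsum scaler_sumr.
  rewrite exchange_big; apply: eq_bigr => q _ /=.
  by rewrite /g scaler_suml; apply: eq_bigr => r _; rewrite scalerA.
have gZ p c x : g p (c *: x) = c * g p x.
  rewrite /g mulr_sumr; apply: eq_bigr => r _.
  by rewrite -scalerAl scalar_functionalZ mulrCA.
(* Here h(v_kp -) acts on the first leg of the coproduct of b and g_p on the second. Evaluating the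
   first leg beforehand, by [strong_invr], shows the entries of M. *)
transitivity (\sum_p \sum_q h (v k q * b) * g p (opp_invr p q)).
  apply: eq_bigr => p _; rewrite gE.
  rewrite (tlift_swap (haar_mull_scalar (v k p)) (gl p)) strong_invr.
  elim/big_rec2: _ => [|q x y _ <-]; last by rewrite gl.
  by rewrite -(scale0r 0) gZ mul0r.
rewrite exchange_big; apply: eq_bigr => q _ /=.
by rewrite mxE mulr_sumr.
Qed.

End Haar.

(** * Adjoints of matrices over a star-algebra *)

Section Adjoint.
Context (R : realType) (A : starAlgType R).
Local Notation C := R[i].
Local Notation "P ^e" := (map_mx (in_alg A) P) (at level 8, format "P ^e").
Local Open Scope sesquilinear_scope.

Lemma star1 : star (1 : A) = 1.
Proof. by rewrite -[LHS]mul1r -[X in X * _](starK (1 : A)) -starM mul1r starK. Qed.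

Lemma adjmx_mul m n p (v : 'M[A]_(m, n)) (w : 'M[A]_(n, p)) :
  adjmx (v *m w) = adjmx w *m adjmx v.
Proof.
apply/matrixP => i j; rewrite !mxE star_sum; apply: eq_bigr => k _.
by rewrite starM !mxE.
Qed.

Lemma adjmx_scalar m n (P : 'M[C]_(m, n)) : adjmx P^e = (P ^t*)^e.
Proof. by apply/matrixP => i j; rewrite !mxE starZ star1. Qed.

End Adjoint.

(** * The twist on matrix coefficients and on covariant matrices of forms *)

Section Twist.
Context (R : realType) (H : hopf_star_algebra R).
Context (h : {scalar H}) (h_haar : is_haar h).
Context (Om : star_calculus H) (N : nat).
Context (Om_top : has_dim (calc_inv_deg Om N) 1).
Context (theta : Om) (theta_inv : calc_inv_deg Om N theta) (theta0 : theta <> 0).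
Context (itg : {scalar Om}) (itg_integral : is_integral h N theta itg).
Context (sigma : {lrmorphism Om -> Om}) (sigma_twist : is_twist itg sigma).
Local Notation C := R[i].
Local Notation iota := (sc_emb Om).
Local Notation "P ^e" := (map_mx (in_alg H) P) (at level 8, format "P ^e").
Local Notation eO := (map_mx (in_alg Om)).
Local Notation iM := (map_mx iota).

Lemma deg_emb a : calc_deg Om 0 (iota a).
Proof. by rewrite /calc_deg -sc_emb_range; exists a. Qed.

Lemma deg_mul k l x y : calc_deg Om k x -> calc_deg Om l y -> calc_deg Om (k + l) (x * y).
Proof. exact: gr_mul. Qed.

Lemma deg_lin k (c : C) x y :
  calc_deg Om k x -> calc_deg Om k y -> calc_deg Om k (c *: x + y).
Proof. exact: gr_deg_lin. Qed.

Lemma deg_sum k (I : Type) (r : seq I) (P : pred I) (F : I -> Om) :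
  (forall i, P i -> calc_deg Om k (F i)) -> calc_deg Om k (\sum_(i <- r | P i) F i).
Proof.
move=> FP; elim/big_rec: _ => [|i x Pi xk]; first exact: gr_deg0.
by rewrite -[F i]scale1r; apply: deg_lin => //; exact: FP.
Qed.

Lemma inv_lin (c : C) x y :
  calc_inv Om x -> calc_inv Om y -> calc_inv Om (c *: x + y).
Proof.
by rewrite /calc_inv /= => xi yi; rewrite linearP /= xi yi tpureDr tpureZr.
Qed.

Lemma inv_mul x y : calc_inv Om x -> calc_inv Om y -> calc_inv Om (x * y).
Proof. by rewrite /calc_inv /= => xi yi; rewrite rmorphM /= xi yi tpureM mulr1. Qed.

Lemma inv1 : calc_inv Om 1.
Proof. by rewrite /calc_inv /= rmorph1. Qed.

Lemma inv_deg_lin k (c : C) x y :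
  calc_inv_deg Om k x -> calc_inv_deg Om k y -> calc_inv_deg Om k (c *: x + y).
Proof. by move=> [xk xi] [yk yi]; split; [exact: deg_lin|exact: inv_lin]. Qed.

Lemma inv_deg0 k : calc_inv_deg Om k 0.
Proof. by split; [exact: gr_deg0|rewrite /calc_inv /= linear0 tpure0r]. Qed.

Lemma inv_deg_sum k (I : Type) (r : seq I) (P : pred I) (F : I -> Om) :
  (forall i, P i -> calc_inv_deg Om k (F i)) ->
  calc_inv_deg Om k (\sum_(i <- r | P i) F i).
Proof.
move=> FP; elim/big_rec: _ => [|i x Pi xk]; first exact: inv_deg0.
by rewrite -[F i]scale1r; apply: inv_deg_lin => //; exact: FP.
Qed.

Lemma top_form z : calc_inv_deg Om N z -> exists c, z = c *: theta.
Proof.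
move: theta_inv; have [b [_ ->]] := Om_top.
move=> /lspan_rangeP[c cE] /lspan_rangeP[e ->]; move: cE; rewrite !big_ord1 => cE.
have c0 : c ord0 != 0 by apply/eqP => c0; apply: theta0; rewrite cE c0 scale0r.
by exists (e ord0 / c ord0); rewrite cE scalerA divfK.
Qed.

Section Covariant.
Context (n : nat) (v : 'M[H]_n) (vP : unitary_corep v).

Lemma coact_emb_coef i j :
  sc_coact Om (iota (v i j)) = \sum_k v i k *t iota (v k j).
Proof.
rewrite sc_coact_emb comul_coef // (tmap_sum (@id_linear _ H) (linearP iota)).
by apply: eq_bigr => k _; rewrite (tmap_pure (@id_linear _ H) (linearP iota)).
Qed.

Lemma coact_emb_star_coef i j :
  sc_coact Om (iota (star (v i j))) = \sum_k star (v i k) *t iota (star (v k j)).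
Proof.
rewrite sc_coact_emb comul_star_coef // (tmap_sum (@id_linear _ H) (linearP iota)).
by apply: eq_bigr => k _; rewrite (tmap_pure (@id_linear _ H) (linearP iota)).
Qed.

Definition covariant (X : 'M[Om]_n) : Prop :=
  forall i j, sc_coact Om (X i j) = \sum_k v i k *t X k j.

(** In the coaction of an entry, the H-legs recombine into entries of the product of the adjoint of
    v with v, which is the identity. *)
Lemma covariant_inv X : covariant X ->
  forall i j, calc_inv Om ((iM (adjmx v) *m X) i j).
Proof.
move=> Xcov i j; rewrite /calc_inv /= mxE linear_sum tpure_sumr /=.
transitivity (\sum_k \sum_m \sum_p
    (star (v k m) * v k p) *t (iota (star (v m i)) * X p j)).
  apply: eq_bigr => k _; rewrite rmorphM /= Xcov !mxE coact_emb_star_coef //.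
  rewrite mulr_suml; apply: eq_bigr => m _; rewrite mulr_sumr.
  by apply: eq_bigr => p _; rewrite tpureM.
rewrite exchange_big; apply: eq_bigr => m _ /=.
rewrite exchange_big (bigD1 m) //= [X in _ + X]big1 ?addr0.
  by rewrite -tpure_suml adjmx_mul_coef // eqxx !mxE.
move=> p pm; rewrite -tpure_suml adjmx_mul_coef // eq_sym (negPf pm).
by rewrite tpure0l.
Qed.

Lemma covariantK (X : 'M[Om]_n) : iM v *m (iM (adjmx v) *m X) = X.
Proof. by have [_ vv _] := vP; rewrite mulmxA -map_mxM vv map_mx1 mul1mx. Qed.

Lemma covariant_d : covariant (map_mx (gd_d Om) (iM v)).
Proof.
move=> i j; rewrite !mxE -sc_coact_d coact_emb_coef //.
rewrite (tmap_sum (@id_linear _ H) (linearP (gd_d Om))).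
by apply: eq_bigr => k _; rewrite (tmap_pure (@id_linear _ H) (linearP _)) !mxE.
Qed.

Lemma covariant_mul eta : calc_inv Om eta -> covariant (eta *: (iM v : 'M[Om]_n)).
Proof.
move=> ei i j; rewrite !mxE rmorphM /= ei coact_emb_coef //.
rewrite mulr_sumr; apply: eq_bigr => k _.
by rewrite tpureM mul1r !mxE.
Qed.

(** Conjugating theta by v gives left-invariant entries of degree N, hence scalar multiples of
    theta. *)
Lemma top_form_corep : exists K : 'M[C]_n,
  forall i j, theta * iota (v i j) = \sum_k K k j *: (iota (v i k) * theta).
Proof.
have [tN ti] := theta_inv.
pose Z := iM (adjmx v) *m (theta *: (iM v : 'M[Om]_n)).
have Zinv (p : 'I_n * 'I_n) : exists c, Z p.1 p.2 = c *: theta.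
  apply: top_form; split; last by apply: covariant_inv; exact: covariant_mul.
  rewrite mxE; apply: deg_sum => k _; rewrite -[N]add0n !mxE.
  apply: deg_mul; first exact: deg_emb.
  by rewrite -[N]addn0; apply: deg_mul => //; exact: deg_emb.
have [c cE] := choice Zinv.
exists (\matrix_(k, j) c (k, j)) => i j.
have /matrixP/(_ i j) := covariantK (theta *: (iM v : 'M[Om]_n)).
rewrite -/Z mxE [in RHS]mxE [in RHS]mxE => <-.
by apply: eq_bigr => k _; rewrite -[Z k j]/(Z (k, j).1 (k, j).2) cE !mxE scalerAr.
Qed.

End Covariant.

Lemma twist_restriction : exists s : {lrmorphism H -> H},
  forall a, iota (s a) = sigma (iota a).
Proof.
have [_ sdeg _ _] := sigma_twist.
have sr a : exists b, iota b = sigma (iota a).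
  have : calc_deg Om 0 (sigma (iota a)) by apply: sdeg; exact: deg_emb.
  by rewrite /calc_deg -sc_emb_range => -[b _ <-]; exists b.
have [s sE] := choice sr.
have slin : linear s.
  by move=> c x y; apply: (@sc_emb_inj _ _ Om); rewrite sE !linearP /= !sE.
have smul : monoid_morphism s.
  by split=> [|x y]; apply: (@sc_emb_inj _ _ Om);
    rewrite !(rmorphM, rmorph1, sE) /= ?rmorph1 ?rmorphM ?sE.
exists (HB.pack_for {lrmorphism H -> H} s
  (GRing.isLinear.Build C H H _ s slin) (GRing.isMonoidMorphism.Build H H s smul)).
exact: sE.
Qed.

Context (s : {lrmorphism H -> H}) (sE : forall a, iota (s a) = sigma (iota a)).

Lemma haar_mulr_inj x y : (forall b, h (x * b) = h (y * b)) -> x = y.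
Proof.
move=> xy; apply/eqP; rewrite -subr_eq0 -(inj_eq (inv_inj (@starK _ H))) star0.
apply/eqP; apply: (haar_faithful h_haar); rewrite starK mulrBl.
by rewrite linearB /= xy subrr.
Qed.

Section Corep.
Context (n : nat) (v : 'M[H]_n) (vP : unitary_corep v).
Local Notation F := (gram_col h v).

(** Pairing with b under h, the twist property gives h(s(v) b) = h(b v) K, and [haar_modular] gives
    h(b F v) = h(v b) M. So D = M K works, by faithfulness of h. *)
Lemma twist_corep : exists D : 'M[C]_n, F^e *m map_mx s v = v *m D^e.
Proof.
have [M ME] := haar_modular h_haar vP; have [K KE] := top_form_corep vP.
have [tN _] := theta_inv; have [_ _ _ stw] := sigma_twist.
have [_ itgE] := itg_integral.
have hs i j b : h (s (v i j) * b) = \sum_k K k j * h (b * v i k).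
  rewrite -itgE rmorphM /= -mulrA sE -[LHS]mul1r.
  (* v_ij has degree 0, so no sign arises when it is moved across b theta. *)
  have := stw 0 N (iota (v i j)) (iota b * theta) (deg_emb _) (deg_mul (deg_emb b) tN).
  rewrite mul0n expr0 => <-; rewrite -mulrA KE mulr_sumr linear_sum.
  apply: eq_bigr => k _.
  by rewrite -scalerAr scalar_functionalZ mulrA -rmorphM itgE.
exists (M *m K); apply/matrixP => k j; apply: haar_mulr_inj => b.
rewrite mul_scalar_mxE mul_mx_scalarE !mulr_suml !linear_sum /=.
transitivity (\sum_r \sum_l K l j * (F k r * h (b * v r l))).
  apply: eq_bigr => r _; rewrite [map_mx s v _ _]mxE -scalerAl.
  rewrite scalar_functionalZ hs mulr_sumr.
  by apply: eq_bigr => l _; rewrite mulrCA.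
rewrite exchange_big.
transitivity (\sum_l K l j * \sum_q h (v k q * b) * M q l).
  by apply: eq_bigr => l _; rewrite -mulr_sumr ME.
under [LHS]eq_bigr do rewrite mulr_sumr.
rewrite [LHS]exchange_big; apply: eq_bigr => q _ /=.
rewrite -scalerAl scalar_functionalZ mxE mulr_suml; apply: eq_bigr => l _.
by ring.
Qed.

Context (D : 'M[C]_n) (DE : F^e *m map_mx s v = v *m D^e).
Local Open Scope sesquilinear_scope.

(** As s is multiplicative, it sends the adjoint of v to the inverse of s(v); this inverts the
    relation [DE] without any compatibility of s with the star. *)
Lemma twist_adjmx : D^e *m map_mx s (adjmx v) = adjmx v *m F^e.
Proof.
have [av va _] := vP.
rewrite -[LHS]mul1mx -av -!mulmxA (mulmxA v) -DE -!mulmxA -map_mxM va map_mx1.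
by rewrite mulmx1.
Qed.

Lemma map_mx_twist_scalar m p (P : 'M[C]_(m, p)) : map_mx s P^e = P^e.
Proof. by apply/matrixP => i j; rewrite !mxE linearZ /= rmorph1. Qed.

(** F is invertible and s(v) has a left inverse, so D x = 0 forces s(v) x = 0 and x = 0. *)
Lemma twist_corep_unit : D \in unitmx.
Proof.
rewrite -unitmx_tr -row_free_unit -kermx_eq0; apply/rowV0P => x /sub_kermxP xD.
have {}xD : D *m x^T = 0 by rewrite -[D]trmxK -trmx_mul xD trmx0.
have [av _ _] := vP.
have Fu := gram_col_unit h_haar vP.
have : (invmx F)^e *m (v *m D^e *m (x^T)^e) = 0.
  by rewrite -mulmxA -map_mxM xD map_mx0 !mulmx0.
rewrite -DE !mulmxA -map_mxM mulVmx // map_mx1 mul1mx.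
move/(congr1 (mulmx (map_mx s (adjmx v)))).
rewrite mulmx0 mulmxA -map_mxM av map_mx1 mul1mx => /matrixP x0.
apply/rowP => i; have := x0 i 0; rewrite !mxE => /eqP.
by rewrite scaler_eq0 oner_eq0 orbF => /eqP.
Qed.

(** With F = U^* diag(l) U and a = U v y, the sum of l_r h(star a_r * s a_r) is y^* v^* F s(v) y =
    y^* v^* v D y = y^* D y. *)
Lemma twist_corep_positive : (forall a, 0 <= h (star a * s a)) -> positive_form D.
Proof.
move=> spos y; have [av _ _] := vP.
have [U [l [_ l0 FE]]] := positive_form_spectral (gram_col_positive h_haar v).
pose Y : 'cV[C]_n := \col_j y j.
pose a := U^e *m v *m Y^e.
have -> : \sum_i \sum_j (y i)^* * D i j * y j = (Y ^t* *m D *m Y) 0 0.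
  rewrite mxE exchange_big; apply: eq_bigr => j _; rewrite !mxE mulr_suml.
  by apply: eq_bigr => i _; rewrite !mxE.
have FX p (X : 'M[H]_(n, p)) :
    (U ^t*)^e *m ((diag_mx (\row_i l i))^e *m (U^e *m X)) = F^e *m X.
  by rewrite !mulmxA -!map_mxM -FE.
have aE : adjmx a *m ((diag_mx (\row_i l i))^e *m map_mx s a) = (Y ^t* *m D *m Y)^e.
  rewrite /a !map_mxM /= !map_mx_twist_scalar !adjmx_mul !adjmx_scalar.
  rewrite -!mulmxA FX (mulmxA F^e) DE -!mulmxA (mulmxA (adjmx v)) av mul1mx.
  by rewrite !mulmxA.
have := congr1 (fun Z : 'M[H]_1 => h (Z 0 0)) aE.
rewrite /= [in RHS]mxE scalar_functionalZ (haar1 h_haar) mulr1 => <-.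
rewrite mxE linear_sum sumr_ge0 // => r _; rewrite mul_scalar_mxE (bigD1 r) //=.
rewrite [X in _ + X]big1 ?addr0 => [|k kr]; last first.
  by rewrite mxE eq_sym (negPf kr) scale0r.
rewrite -scalerAr scalar_functionalZ [adjmx _ _ _]mxE mulr_ge0 //.
  by rewrite !mxE eqxx mulr1n.
by rewrite [map_mx s a _ _]mxE.
Qed.

End Corep.

Definition pos_eigen k : set Om :=
  [set eta | calc_inv_deg Om k eta /\ exists2 c : C, 0 < c & sigma eta = c *: eta].

Definition pos_span k : set Om :=
  lspan [set w | exists a eta, pos_eigen k eta /\ w = iota a * eta].

Lemma pos_span_eigen k eta : pos_eigen k eta -> pos_span k eta.
Proof. by move=> ek; apply: sub_lspan; exists 1, eta; rewrite rmorph1 mul1r. Qed.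

Lemma pos_span_mull k a w : pos_span k w -> pos_span k (iota a * w).
Proof.
move: w; apply: lspan_min => [|c x y ax ay|_ [b [eta [ek ->]]]].
- by rewrite mulr0; exact: lspan0.
- by rewrite mulrDr -scalerAr; exact: lspan_lin.
by apply: sub_lspan; exists (a * b), eta; rewrite rmorphM mulrA.
Qed.

(** The matrix W = v^* X is left-invariant and satisfies sigma(W) = c D^-1 W D. In an orthonormal
    eigenbasis of D its entries become eigenvectors of sigma, and X is recovered from them with
    coefficients in H. *)
Lemma covariant_pos_span n (v : 'M[H]_n) (vP : unitary_corep v) (D : 'M[C]_n)
    (X : 'M[Om]_n) (c : C) k :
  (forall a, 0 <= h (star a * s a)) ->
  (gram_col h v)^e *m map_mx s v = v *m D^e ->
  covariant v X -> (forall i j, calc_deg Om k (X i j)) -> 0 < c ->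
  eO (gram_col h v) *m map_mx sigma X = X *m eO (c *: D) ->
  forall i j, pos_span k (X i j).
Proof.
move=> spos DE Xcov Xk c0 XE; set F := gram_col h v in DE XE.
have [U [m [Uu m0 UE]]] := positive_form_spectral (twist_corep_positive vP DE spos).
have mu : forall i, 0 < m i.
  move=> i; rewrite lt_neqAle m0 andbT eq_sym.
  have := twist_corep_unit vP DE.
  rewrite UE !unitmx_mul => /andP[/andP[_ +] _].
  by rewrite unitmxE det_diag unitfE => /prodf_neq0/(_ i isT); rewrite mxE.
set d := diag_mx _ in UE.
have iMe p q (P : 'M[C]_(p, q)) : iM P^e = eO P.
  by apply/matrixP => i j; rewrite !mxE linearZ /= rmorph1.
have sMe p q (P : 'M[C]_(p, q)) : map_mx sigma (eO P) = eO P.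
  by apply/matrixP => i j; rewrite !mxE linearZ /= rmorph1.
have sMi p q (P : 'M[H]_(p, q)) : map_mx sigma (iM P) = iM (map_mx s P).
  by apply/matrixP => i j; rewrite !mxE sE.
pose W := iM (adjmx v) *m X.
have WE : eO D *m map_mx sigma W = W *m eO (c *: D).
  have := congr1 (fun Z : 'M[H]_n => iM Z) (twist_adjmx vP DE).
  rewrite /W !map_mxM /= !iMe sMi mulmxA => ->.
  by rewrite -!mulmxA XE.
(* U diagonalises D, so W' satisfies the relation of W with D replaced by the diagonal matrix d. *)
pose W' := eO U *m W *m eO (U ^t*)%sesqui.
have UU : U *m (U ^t*)%sesqui = 1%:M by exact/unitarymxP.
have UU' : (U ^t*)%sesqui *m U = 1%:M by exact: mulmx1C.
have W'E : eO d *m map_mx sigma W' = W' *m eO (c *: d).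
  have dU : d *m U = U *m D by rewrite UE !mulmxA UU mul1mx.
  have Ud : (c *: D) *m (U ^t*)%sesqui = (U ^t*)%sesqui *m (c *: d).
    by rewrite -scalemxAl -scalemxAr UE -!mulmxA UU mulmx1.
  rewrite /W' map_mxM map_mxM /= !sMe !mulmxA -map_mxM dU map_mxM -(mulmxA (eO U)) WE.
  by rewrite -!mulmxA -!map_mxM Ud.
have W'inv i j : calc_inv_deg Om k (W' i j).
  rewrite mul_mx_scalarE; apply: inv_deg_sum => q _.
  rewrite -[_ *: _]addr0; apply: inv_deg_lin; last exact: inv_deg0.
  rewrite mul_scalar_mxE; apply: inv_deg_sum => p _.
  rewrite -[_ *: _]addr0; apply: inv_deg_lin; last exact: inv_deg0.
  split; last exact: (covariant_inv vP Xcov).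
  rewrite mxE; apply: deg_sum => r _; rewrite -[k]add0n mxE.
  by apply: deg_mul => //; exact: deg_emb.
have W'e i j : pos_eigen k (W' i j).
  (* Entry (i, j) of [W'E] reads m_i sigma(W'_ij) = c m_j W'_ij. *)
  split=> //; exists (c * m j / m i); first by rewrite divr_gt0 ?mulr_gt0.
  have /matrixP/(_ i j) := W'E; rewrite mul_scalar_mxE mul_mx_scalarE.
  rewrite (bigD1 i) //= [X in _ + X]big1 ?addr0 => [|r ri]; last first.
    by rewrite mxE eq_sym (negPf ri) scale0r.
  rewrite (bigD1 j) //= [X in _ = _ + X]big1 ?addr0 => [|r ri]; last first.
    by rewrite !mxE (negPf ri) mulr0 scale0r.
  rewrite !mxE !eqxx !mulr1n => e.
  rewrite mulrC -scalerA -[in RHS]e scalerA mulVf ?scale1r //.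
  by rewrite gt_eqF.
have XE' : X = iM v *m (eO (U ^t*)%sesqui *m W' *m eO U).
  rewrite /W' -!mulmxA -!map_mxM UU' map_mx1 mulmx1 !mulmxA.
  rewrite -(mulmxA (iM v)) -map_mxM UU' map_mx1 mulmx1.
  by rewrite -mulmxA (covariantK vP).
move=> i j; rewrite XE' mxE; apply: lspan_sum => r _.
rewrite mxE; apply: pos_span_mull; rewrite mul_mx_scalarE; apply: lspan_sum => q _.
apply: lspanZ; rewrite mul_scalar_mxE; apply: lspan_sum => p _.
by apply: lspanZ; exact: pos_span_eigen.
Qed.

End Twist.

(** * Positive eigenvectors span the calculus *)

Section Structure.
Context (R : realType) (H : hopf_star_algebra R).
Context (h : {scalar H}) (h_haar : is_haar h).
Context (Om : star_calculus H) (N : nat).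
Context (Om_top : has_dim (calc_inv_deg Om N) 1).
Context (theta : Om) (theta_inv : calc_inv_deg Om N theta) (theta0 : theta <> 0).
Context (itg : {scalar Om}) (itg_integral : is_integral h N theta itg).
Context (coefs_span : forall a : H, lspan [set x | exists n (v : 'M[H]_n),
  unitary_corep v /\ exists i j, x = v i j] a).
Context (sigma : {lrmorphism Om -> Om}) (sigma_twist : is_twist itg sigma).
Local Notation C := R[i].
Local Notation iota := (sc_emb Om).
Local Notation "P ^e" := (map_mx (in_alg H) P) (at level 8, format "P ^e").
Local Notation eO := (map_mx (in_alg Om)).
Local Notation iM := (map_mx iota).


Context (s : {lrmorphism H -> H}) (sE : forall a, iota (s a) = sigma (iota a)).
Context (s_pos : forall a, 0 <= h (star a * s a)).

Local Notation pos_eigen := (@pos_eigen R H Om sigma).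
Local Notation pos_span := (@pos_span R H Om sigma).

(** The common form of the two cases T(a) = da and T(a) = eta a: applying c T to F s(v) = v D gives
    the twisting relation required by [covariant_pos_span]. *)
Lemma equivariant_pos_span (T : H -> Om) (c : C) k : linear T ->
  (forall n (v : 'M[H]_n), unitary_corep v -> covariant v (map_mx T v)) ->
  (forall a, calc_deg Om k (T a)) -> 0 < c ->
  (forall a, sigma (T a) = c *: T (s a)) -> forall a, pos_span k (T a).
Proof.
move=> Tl Tcov Tk c0 sT a.
have T0 := linear_fun0 Tl; have TZ := linear_funZ Tl.
have TD x y : T (x + y) = T x + T y by have := Tl 1 x y; rewrite !scale1r.
move: (coefs_span a); move: a.
apply: lspan_min => [|e x y Tx Ty|_ [n [v [vP [i [j ->]]]]]].
- by rewrite T0; exact: lspan0.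
- by rewrite Tl; exact: lspan_lin.
have [D DE] := twist_corep h_haar Om_top theta_inv theta0 itg_integral sigma_twist sE vP.
have -> : T (v i j) = map_mx T v i j by rewrite mxE.
apply: (covariant_pos_span h_haar sE vP s_pos DE (Tcov _ _ vP) _ c0).
  by move=> p q; rewrite mxE.
apply/matrixP => p q; rewrite mul_scalar_mxE mul_mx_scalarE.
have /matrixP/(_ p q) := DE; rewrite mul_scalar_mxE mul_mx_scalarE.
move/(congr1 (fun x => c *: T x)).
have TS (I : finType) (G : I -> H) : T (\sum_i G i) = \sum_i T (G i).
  exact: (big_morph T TD T0).
rewrite !TS !scaler_sumr => e.
under eq_bigr => r _ do rewrite 2![map_mx _ _ _ _]mxE sT.
under [RHS]eq_bigr => r _ do rewrite [map_mx _ _ _ _]mxE mxE -scalerA -TZ.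
rewrite -e; apply: eq_bigr => r _.
by rewrite [map_mx s _ _ _]mxE TZ !scalerA mulrC.
Qed.

Lemma d_emb_pos_span b : pos_span 1 (gd_d Om (iota b)).
Proof.
have [_ _ sd _] := sigma_twist.
apply: (@equivariant_pos_span (fun a => gd_d Om (iota a)) 1) => //.
- by move=> c x y; rewrite !linearP.
- by move=> n v vP; have := covariant_d Om vP; congr covariant;
    apply/matrixP => i j; rewrite !mxE.
- by move=> a; apply/gd_d_deg/deg_emb.
by move=> a; rewrite sd sE scale1r.
Qed.

Lemma eigen_mulr_pos_span k eta b : pos_eigen k eta -> pos_span k (eta * iota b).
Proof.
move=> [[etak etai] [c c0 etac]].
apply: (@equivariant_pos_span (fun a => eta * iota a) c) => //.
- by move=> e x y; rewrite linearP /= mulrDr -scalerAr.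
- by move=> n v vP; have := covariant_mul vP etai; congr covariant;
    apply/matrixP => i j; rewrite !mxE.
- by move=> a; rewrite -[k]addn0; apply: deg_mul => //; exact: deg_emb.
by move=> a; rewrite rmorphM /= etac -sE -scalerAl.
Qed.

Lemma pos_eigen1 : pos_eigen 0 1.
Proof.
split; last by exists 1; rewrite ?ltr01 // rmorph1 scale1r.
by split; [rewrite -(rmorph1 iota); exact: deg_emb|exact: inv1].
Qed.

Lemma pos_eigenM k l x y : pos_eigen k x -> pos_eigen l y -> pos_eigen (k + l) (x * y).
Proof.
move=> [[xk xi] [c c0 xc]] [[yl yi] [e e0 ye]]; split.
  by split; [exact: deg_mul|exact: inv_mul].
by exists (c * e); rewrite ?mulr_gt0 // rmorphM /= xc ye scalerMM.
Qed.

(** A coefficient between two eigenvectors is moved to the left by [eigen_mulr_pos_span], after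
    which eigenvectors meet and their eigenvalues multiply. *)
Lemma pos_spanM k l x y : pos_span k x -> pos_span l y -> pos_span (k + l) (x * y).
Proof.
move=> xk yl; move: x xk.
apply: lspan_min => [|c x x' xy x'y|_ [a [eta [ek ->]]]].
- by rewrite mul0r; exact: lspan0.
- by rewrite mulrDl -scalerAl; exact: lspan_lin.
rewrite -mulrA; apply: pos_span_mull; move: y yl.
apply: lspan_min => [|c y y' xy x'y|_ [b [eta' [el ->]]]].
- by rewrite mulr0; exact: lspan0.
- by rewrite mulrDr -scalerAr; exact: lspan_lin.
rewrite mulrA; move: (eigen_mulr_pos_span b ek); move: (eta * _).
apply: lspan_min => [|c x x' xy x'y|_ [e [eta'' [ek' ->]]]].
- by rewrite mul0r; exact: lspan0.
- by rewrite mulrDl -scalerAl; exact: lspan_lin.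
by rewrite -mulrA; apply/pos_span_mull/pos_span_eigen/pos_eigenM.
Qed.

Lemma deg_pos_span k w : calc_deg Om k w -> pos_span k w.
Proof.
rewrite /calc_deg sc_span; move: w; apply: lspan_sub => _ [a [b ->]].
apply: pos_span_mull; elim: k b => [|k IHk] b.
  by rewrite big_ord0; apply/pos_span_eigen/pos_eigen1.
rewrite big_ord_recl; apply: (@pos_spanM 1 k); [exact: d_emb_pos_span|exact: IHk].
Qed.

Definition pos_eigens : set Om := [set eta | exists k, pos_eigen k eta].

Lemma calculus_span w :
  lspan [set w | exists a eta, pos_eigens eta /\ w = iota a * eta] w.
Proof.
have [n [f [fdeg ->]]] := gr_sum w; apply: lspan_sum => i _.
move: (deg_pos_span (fdeg i)); move: (f i).
apply: lspan_sub => _ [a [eta [ek ->]]].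
by apply: sub_lspan; exists a, eta; split=> //; exists i.
Qed.

(** The projection S(w_(-1)) w_(0) onto the left-invariant forms. *)
Definition inv_proj (w : Om) : Om :=
  tlift (fun x y => iota (antipode H x) * y) (sc_coact Om w).

Lemma bilin_inv_proj : bilin (fun (x : H) (y : Om) => iota (antipode H x) * y).
Proof.
split=> [b c x y|a c x y]; last by rewrite mulrDr -scalerAr.
by rewrite !linearP /= mulrDl -scalerAl.
Qed.

Lemma inv_proj_linear : linear inv_proj.
Proof. by move=> c x y; rewrite /inv_proj linearP /= (tlift_linear bilin_inv_proj). Qed.

Lemma antipode1 : antipode H 1 = 1.
Proof.
have := antipodel (1 : H); rewrite !rmorph1 scale1r tlift_pure ?mulr1 //.
split=> [b c x y|a c x y]; last by rewrite mulrDr -scalerAr.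
by rewrite linearP /= mulrDl -scalerAl.
Qed.

Lemma inv_proj_inv eta : calc_inv Om eta -> inv_proj eta = eta.
Proof.
rewrite /calc_inv /inv_proj /= => ->; rewrite (tlift_pure _ _ bilin_inv_proj).
by rewrite antipode1 rmorph1 mul1r.
Qed.

Lemma coact_mul_inv (V : lmodType C) (f : H -> Om -> V) a eta :
  bilin f -> calc_inv Om eta ->
  tlift f (sc_coact Om (iota a * eta)) =
  tlift (fun x y => f x (iota y * eta)) (comul H a).
Proof.
move=> bf ei; rewrite rmorphM /= ei sc_coact_emb.
have bg : bilin (fun x y => f x (iota y * eta)).
  split=> [b c x y|b c x y]; first exact: bf.1.
  by rewrite linearP /= mulrDl -scalerAl bf.2.
have tl := tmap_linear (@id_linear _ H) (linearP iota).
move: (comul H a); apply: tlift_uniq => [c x y|c x y|x y].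
- by rewrite tl mulrDl -scalerAl (tlift_linear bf).
- exact: tlift_linear.
rewrite (tmap_pure (@id_linear _ H) (linearP iota)) tpureM mulr1.
by rewrite (tlift_pure _ _ bf) (tlift_pure _ _ bg).
Qed.

Lemma inv_proj_mul a eta : calc_inv Om eta -> inv_proj (iota a * eta) = counit H a *: eta.
Proof.
move=> ei; rewrite /inv_proj (coact_mul_inv _ bilin_inv_proj ei).
have bS : bilin (fun x y : H => antipode H x * y).
  split=> [b c x y|b c x y]; last by rewrite mulrDr -scalerAr.
  by rewrite linearP /= mulrDl -scalerAl.
have bg : bilin (fun x y => iota (antipode H x) * (iota y * eta)).
  split=> [b c x y|b c x y]; first exact: bilin_inv_proj.1.
  by rewrite linearP /= mulrDl mulrDr -scalerAl -scalerAr.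
transitivity (iota (tlift (fun x y => antipode H x * y) (comul H a)) * eta).
  move: (comul H a); apply: tlift_uniq => [c x y|c x y|x y].
  - exact: tlift_linear.
  - by rewrite (tlift_linear bS) linearP /= mulrDl -scalerAl.
  by rewrite (tlift_pure _ _ bS) (tlift_pure _ _ bg) rmorphM mulrA.
by rewrite antipodel linearZ /= rmorph1 -scalerAl mul1r.
Qed.

(** An invariant form is fixed by [inv_proj], which sends each term a eta of its expansion to the
    scalar multiple counit(a) eta. *)
Lemma calc_inv_span : calc_inv Om = lspan pos_eigens.
Proof.
rewrite eqEsubset; split; last first.
  apply: lspan_min => [|c x y|eta [k [[_ +] _]]] //; last exact: inv_lin.
  by have [] := inv_deg0 Om 0.
move=> w wi; rewrite -(inv_proj_inv wi); move: (calculus_span w).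
move: {wi} w; apply: lspan_min => [|c x y xE yE|_ [a [eta [etaE ->]]]].
- have /inv_proj_inv -> : calc_inv Om 0 by have [] := inv_deg0 Om 0.
  exact: lspan0.
- by rewrite inv_proj_linear; exact: lspan_lin.
have [k [[_ ei] _]] := etaE.
by rewrite inv_proj_mul //; apply/lspanZ/sub_lspan.
Qed.

(** Om is free over H on a basis of left-invariant homogeneous eigenvectors; [co] are the
    coordinates in H, and on invariant forms they are scalars. *)
Lemma twisted_coordinates : strongly_finite_dim Om ->
  exists m (b : 'I_m -> Om) (deg : 'I_m -> nat) (lam : 'I_m -> C)
    (co : 'I_m -> Om -> H),
  [/\ forall i, calc_deg Om (deg i) (b i),
      forall i, 0 < lam i /\ sigma (b i) = lam i *: b i &
      forall i, linear (co i)] /\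
  [/\
      forall w, w = \sum_i iota (co i w) * b i,
      forall i j a, co i (iota a * b j) = (i == j)%:R *: a &
      forall w, calc_inv Om w -> exists e : 'I_m -> C,
        forall a i, co i (iota a * w) = e i *: a].
Proof.
case=> n; rewrite {1}calc_inv_span => /basis_in_spanning_set[m [b [bfree bE spanE]]].
have /choice[deg degP] := bE.
have lamE i : exists c : C, 0 < c /\ sigma (b i) = c *: b i.
  by have [_ [c c0 cE]] := degP i; exists c.
have /choice[lam lamP] := lamE.
have [f fb] := dual_family bfree.
(* The dual functional f_i composed with [inv_proj] is applied to the second leg of the coaction; on
   a w with w invariant, the counit axiom reduces it to f_i(w) a. *)
pose co i w := tlift (fun x y => f i (inv_proj y) *: x) (sc_coact Om w).
have bco i : bilin (fun (x : H) (y : Om) => f i (inv_proj y) *: x).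
  split=> [y c x x'|x c y y']; first by rewrite scalerDr !scalerA mulrC.
  by rewrite inv_proj_linear linearP /= scalerDl scalerA.
have coE i a w : calc_inv Om w -> co i (iota a * w) = f i w *: a.
  move=> wi; rewrite /co (coact_mul_inv _ (bco i) wi) -[in RHS](counitr a).
  rewrite /tlift /tsum scaler_sumr; apply: eq_bigr => p _.
  by rewrite inv_proj_mul // scalar_functionalZ scalerA mulrC.
have col i : linear (co i) by move=> c x y; rewrite /co linearP (tlift_linear (bco i)).
exists m, b, deg, lam, co; do 2!split=> //.
- by move=> i; have [[]] := degP i.
- move=> w; move: (calculus_span w); move: w.
  apply: lspan_min => [|c x y xE yE|_ [a [eta [etaE ->]]]].
  + rewrite big1 // => i _; rewrite (linear_fun0 (col i)).
    by rewrite rmorph0 mul0r.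
  + rewrite [in LHS]xE [in LHS]yE scaler_sumr -big_split; apply: eq_bigr => i _ /=.
    by rewrite col linearP /= mulrDl -scalerAl.
  have [k [[_ ei] _]] := etaE.
  have : lspan (range b) eta by rewrite -spanE; exact: sub_lspan.
  move=> /lspan_rangeP[e etaE']; under eq_bigr do rewrite coE //.
  rewrite {1}etaE' mulr_sumr; apply: eq_bigr => i _.
  rewrite linearZ /= -scalerAl -scalerAr; congr (_ *: _).
  rewrite etaE' linear_sum (bigD1 i) //= scalar_functionalZ fb eqxx mulr1.
  rewrite big1 ?addr0 // => l li.
  by rewrite scalar_functionalZ fb eq_sym (negPf li) mulr0.
- by move=> i j a; have [[_ bi] _] := degP j; rewrite coE ?fb.
by move=> w wi; exists (fun i => f i w) => a i; exact: coE.
Qed.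

End Structure.

(** * The inner product given by coordinates over h *)

(** The 2 x 2 Gram matrix of b and a under h is a positive form, hence Hermitian. *)
Lemma haar_hermitian (R : realType) (H : hopf_star_algebra R) (h : {scalar H}) :
  is_haar h -> forall a b : H, h (star a * b) = (h (star b * a))^*.
Proof.
move=> h_haar a b; pose x (i : 'I_2) := if i == 0 then b else a.
pose A : 'M[R[i]]_2 := \matrix_(i, j) h (star (x i) * x j).
have Apos : positive_form A.
  move=> y; have := haar_ge0 h_haar (\sum_i y i *: x i).
  rewrite star_sum mulr_suml linear_sum /=; congr (_ <= _); apply: eq_bigr => i _.
  rewrite mulr_sumr linear_sum; apply: eq_bigr => j _ /=.
  by rewrite starZ scalerMM scalar_functionalZ mxE mulrAC.
by have := positive_form_hermitian Apos 0 1; rewrite !mxE.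
Qed.

Lemma coordinate_inner_product (R : realType) (H : hopf_star_algebra R)
    (h : {scalar H}) (Om : star_calculus H) m (b : 'I_m -> Om) (co : 'I_m -> Om -> H) :
  is_haar h -> (forall i, linear (co i)) ->
  (forall w, w = \sum_i sc_emb Om (co i w) * b i) ->
  is_inner_product (fun w w' : Om => \sum_i h (star (co i w') * co i w)).
Proof.
move=> h_haar co_lin coE; split=> [c x y z|x y|x|x].
- rewrite mulr_sumr -big_split; apply: eq_bigr => i _ /=.
  by rewrite co_lin mulrDr -scalerAr linearP.
- rewrite rmorph_sum; apply: eq_bigr => i _; exact: haar_hermitian.
- by rewrite sumr_ge0 // => i _; exact: haar_ge0.
move=> /eqP; rewrite psumr_eq0 => [/allP x0|i _]; last exact: haar_ge0.
rewrite (coE x) big1 // => i _.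
have /eqP/(haar_faithful h_haar) -> := x0 i (mem_index_enum i).
by rewrite rmorph0 mul0r.
Qed.

Section Coordinates.
Context (R : realType) (H : hopf_star_algebra R) (Om : star_calculus H).
Context (m : nat) (b : 'I_m -> Om) (deg : 'I_m -> nat) (co : 'I_m -> Om -> H).
Context (b_deg : forall i, calc_deg Om (deg i) (b i)).
Context (co_lin : forall i, linear (co i)).
Context (coE : forall w, w = \sum_i sc_emb Om (co i w) * b i).
Context (b_free : forall i j a, co i (sc_emb Om a * b j) = (i == j)%:R *: a).

Lemma coordinate_sum i (I : Type) (r : seq I) (P : pred I) (F : I -> Om) :
  co i (\sum_(k <- r | P k) F k) = \sum_(k <- r | P k) co i (F k).
Proof.
apply: (big_morph (co i)) => [x y|]; last exact: linear_fun0.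
by have := co_lin i 1 x y; rewrite !scale1r.
Qed.

(** The expansion of w over the basis is compared with w degree by degree; freeness then kills each
    coordinate in a degree other than k. *)
Lemma coordinate_deg k w i : calc_deg Om k w -> deg i <> k -> co i w = 0.
Proof.
move=> wk ik.
(* [g n] is the degree-n part of the expansion of w minus that of w. [M] exceeds every degree
   involved, so the parts below it sum to 0 and vanish one by one. *)
pose g n := \sum_(j | deg j == n) sc_emb Om (co j w) * b j - (n == k)%:R *: w.
pose M := (maxn k (\max_j deg j)).+1.
have g_deg n : calc_deg Om n (g n).
  rewrite /g addrC -scaleNr; have [->|nk] := eqVneq n k; last first.
    rewrite oppr0 scale0r add0r; apply: deg_sum => j /eqP <-.
    by rewrite -[deg j]add0n; apply: deg_mul => //; exact: deg_emb.
  apply: deg_lin => //; apply: deg_sum => j /eqP <-.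
  by rewrite -[deg j]add0n; apply: deg_mul => //; exact: deg_emb.
have kM : (k < M)%N by rewrite ltnS leq_maxl.
have jM j : (deg j < M)%N.
  by rewrite ltnS leq_max (leq_bigmax j) orbT.
have g_sum : \sum_(n < M) g n = 0.
  rewrite sumrB; apply/eqP; rewrite subr_eq0; apply/eqP.
  rewrite [RHS](bigD1 (Ordinal kM)) //= eqxx scale1r [X in _ = _ + X]big1; last first.
    move=> n nk; rewrite (_ : (n == k :> nat) = false) ?scale0r //.
    by apply: contra_neqF nk => /eqP nk; apply: val_inj.
  rewrite addr0 [RHS]coE (exchange_big_dep xpredT) //=; apply: eq_bigr => j _.
  rewrite (bigD1 (Ordinal (jM j))) //= big1 ?addr0 // => n /andP[/eqP jn].
  by rewrite -val_eqE /= jn eqxx.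
have := gr_direct g_deg g_sum (jM i).
rewrite /g (_ : (deg i == k) = false) ?scale0r ?subr0; last exact/eqP.
move=> /(congr1 (co i)); rewrite coordinate_sum (bigD1 i) //= b_free eqxx scale1r.
rewrite big1 ?addr0 => [->|j /andP[_ ji]]; last first.
  by rewrite b_free eq_sym (negPf ji) scale0r.
exact: linear_fun0.
Qed.

End Coordinates.

Theorem theorem7p9 (R : realType) (G : compact_quantum_group R)
    (H : hopf_star_algebra R) (HG : associated_hopf G H)
    (h : {scalar H}) (h_haar : is_haar h)
    (Om : star_calculus H) (N : nat)
    (Om_nondeg : nondegenerate_calculus Om N)
    (Om_fin : strongly_finite_dim Om)
    (Om_dim : calculus_dim Om N)
    (Om_top : has_dim (calc_inv_deg Om N) 1)
    (Om_closed : forall k (w : Om), k.+1 = N -> calc_inv_deg Om k w -> gd_d Om w = 0)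
    (ip0 : Om -> Om -> R[i]) (ip0_inner : is_inner_product ip0)
    (theta : Om) (theta_vol : volume_element ip0 N theta)
    (itg : {scalar Om}) (itg_integral : is_integral h N theta itg)
    (sigma : {lrmorphism Om -> Om}) (sigma_twist : is_twist itg sigma) :
  (exists ip : Om -> Om -> R[i],
     [/\ is_inner_product ip, graded_ip ip, left_invariant_ip h ip &
         forall w : Om, 0 <= ip (sigma w) w]) <->
  (forall a : H, 0 <= h (star a * to_alg (sigma (sc_emb Om a)))).
Proof.
have [s sE] := twist_restriction sigma_twist.
have talg a : to_alg (sigma (sc_emb Om a)) = s a by rewrite -sE to_algK.
split=> [[ip [ip_inner _ ip_inv ip_pos]] a|h_pos].
  have ip11 : 0 < ip 1 1.
    rewrite lt_neqAle (ip_ge0 ip_inner) andbT eq_sym; apply/eqP.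
    by move=> /(ip_eq0 ip_inner)/eqP; rewrite oner_eq0.
  (* With a written as a times the invariant form 1, left invariance yields h(star a * s a) (1 | 1),
     and (1 | 1) > 0. *)
  have := ip_pos (sc_emb Om a).
  rewrite talg -sE -[X in ip X _]mulr1 -[X in ip _ X]mulr1.
  by rewrite ip_inv ?pmulr_lge0 //; exact: inv1.
have s_pos a : 0 <= h (star a * s a) by rewrite -talg.
have [theta_inv _ theta0 _] := theta_vol.
have [m [b [deg [lam [co [[b_deg b_twist co_lin] [coE b_free co_inv]]]]]]] :=
  twisted_coordinates h_haar Om_top theta_inv theta0 itg_integral
    (span_corep_coefs HG) sigma_twist sE s_pos Om_fin.
exists (fun w w' => \sum_i h (star (co i w') * co i w)); split.
- exact: coordinate_inner_product.
- move=> k l x y kl xk yl; rewrite big1 // => i _.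
  have co_deg := coordinate_deg b_deg co_lin coE b_free.
  have [ik|/eqP ik] := eqVneq (deg i) k; last first.
    by rewrite (co_deg _ _ _ xk ik) mulr0 linear0.
  by rewrite (co_deg _ _ _ yl) ?star0 ?mul0r ?linear0 // ik.
- move=> a c w e /co_inv[f fE] /co_inv[g gE].
  rewrite mulr_sumr; apply: eq_bigr => i _.
  have wE := fE 1 i; have eE := gE 1 i; rewrite rmorph1 !mul1r in wE eE.
  rewrite fE gE wE eE !starZ !scalerMM !scalar_functionalZ star1 mulr1 (haar1 h_haar).
  by rewrite mulr1 mulrC.
move=> w; rewrite sumr_ge0 // => i _.
(* The twist acts on coordinates by s and scales the i-th one by its positive eigenvalue. *)
have -> : co i (sigma w) = lam i *: s (co i w).
  rewrite {1}(coE w) rmorph_sum /= coordinate_sum //.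
  have cob j a : co i (sigma (sc_emb Om a * b j)) = lam j *: ((i == j)%:R *: s a).
    by rewrite rmorphM /= (b_twist j).2 -sE -scalerAr linear_funZ // b_free.
  rewrite (bigD1 i) //= cob eqxx scale1r big1 ?addr0 // => j ji.
  by rewrite cob eq_sym (negPf ji) scale0r scaler0.
rewrite -scalerAr scalar_functionalZ mulr_ge0 //.
by rewrite ltW // (b_twist i).1.
Qed.
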